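(* Let $\mathcal C$ be an $N$-dimensional asymptotic class of finite $L$-structures, and let $\mathcal D$ be a class of finite $L'$-structures uniformly parameter-interpretable in $\mathcal C$ by an interpretation of arity $r$ (no trace-reflection hypothesis is imposed). Then $\mathcal D$ is a weak $L_Q$-dimensional asymptotic class. In particular, it is a weak $\operatorname{lcm}(1,2,\dots,Nr)$-dimensional asymptotic class.
   Context: Conventions. Languages $L,L'$ are countable first-order languages, possibly with finitely many sorts; function and constant symbols may be replaced by graph relations. All structures in the classes considered are finite, and $|M|$ is the total number of elements (summed over sorts). Uniform little-$o$. For a collection $\Phi$ (a ''cell'') of pairs $(M,\bar a)$, $f=o(g)$ uniformly on $\Phi$ means: for every $\varepsilon>0$ there is $Q$ with $|f(M,\bar a)|\le\varepsilon g(M,\bar a)$ for all $(M,\bar a)\in\Phi$ with $|M|>Q$. $N$-dimensional asymptotic class ($N\ge1$). A class $\mathcal C$ of finite $L$-structures such that for every $L$-formula $\varphi(x;\bar y)$ with a single object variable $x$ there are a finite set $D_\varphi\subseteq(\{0,\dots,N\}\times\mathbb R_{>0})\cup\{(0,0)\}$ and, for each $(d,\mu)\in D_\varphi$, a parameter-free $L$-formula $\theta_{d,\mu}(\bar y)$ such that in every $M\in\mathcal C$ the sets $\theta_{d,\mu}(M^{|\bar y|})$ partition $M^{|\bar y|}$, and, uniformly on the cell $\{(M,\bar a):M\models\theta_{d,\mu}(\bar a)\}$, $|\varphi(M;\bar a)|=\mu|M|^{d/N}+o(|M|^{d/N})$; for $(0,0)$ this means $|\varphi(M;\bar a)|=o(1)$.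 A weak $N$-dimensional asymptotic class is defined in the same way except that the finitely many cells partitioning the pairs $(M,\bar a)$ are arbitrary sets of pairs and need not be definable by formulas. Uniform parameter-interpretation $\mathcal I$ of $\mathcal D$ in $\mathcal C$, of arity $r\ge1$: an injection $\alpha:\mathcal D\to\mathcal C$; an integer $s\ge0$; fixed $L$-formulas $\delta(\bar u;\bar z)$, $\epsilon(\bar u,\bar v;\bar z)$ with $|\bar u|=|\bar v|=r$, $|\bar z|=s$; for each relation symbol $R\in L'$ a fixed $L$-formula $R^{\mathcal I}$ on the appropriate number of $r$-tuples (and $\bar z$); and for each $A\in\mathcal D$ a tuple $\bar c_A\in\alpha(A)^s$ and an $L'$-isomorphism $\iota_A:A\to X_A/E_A$, where $X_A=\delta(\alpha(A)^r;\bar c_A)$ and $E_A$ is the equivalence relation on $X_A$ defined by $\epsilon(\bar u,\bar v;\bar c_A)$; the formulas $R^{\mathcal I}$ (evaluated at $\bar c_A$) are $E_A$-invariant on $X_A$ and induce the $L'$-structure on $X_A/E_A$. The number $L_Q$. There is a finite family of parameter-free $L$-formulas $\chi_{e,\lambda}(\bar z)$, indexed by pairs $(e,\lambda)\in(\{0,\dots,Nr\}\times\mathbb R_{>0})\cup\{(0,0)\}$, such that for each $A\in\mathcal D$ exactly one $\chi_{e,\lambda}(\bar c_A)$ holds in $M=\alpha(A)$, and uniformly on each cell $|A|=|X_A/E_A|=\lambda|M|^{e/N}+o(|M|^{e/N})$ (as $|M|\to\infty$). Fix such a partition. Let $\mathscr E_Q$ be the set of positive $e$ for which, for some $\lambda>0$,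 the structures $A\in\mathcal D$ with $\alpha(A)\models\chi_{e,\lambda}(\bar c_A)$ have unbounded cardinality. Then $L_Q=\operatorname{lcm}(\mathscr E_Q)$, with $\operatorname{lcm}(\varnothing)=1$. *)

(* Defs.v *)
From HB Require Import structures.
From mathcomp Require Import all_boot all_order all_algebra.
From mathcomp Require Import boolp reals exp.

Set Implicit Arguments.
Unset Strict Implicit.
Unset Printing Implicit Defensive.

Import Order.TTheory GRing.Theory Num.Theory.

Local Open Scope ring_scope.

(* Relational signatures: function and constant symbols are represented by
   their graphs. *)
Record language := Language {
  lsort : finType;
  lrel : countType;
  larity : lrel -> seq lsort }.

(* [tup A [:: s1; ...; sn]] is the finite type A s1 * ... * A sn * unit. *)
Fixpoint tup (S : Type) (A : S -> finType) (G : seq S) : finType :=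
  if G is s :: G' then (A s * tup A G')%type : finType else unit : finType.

Fixpoint tcat (S : Type) (A : S -> finType) (G H : seq S) :
    tup A G -> tup A H -> tup A (G ++ H) :=
  match G return tup A G -> tup A H -> tup A (G ++ H) with
  | [::] => fun _ b => b
  | s :: G' => fun a b => (a.1, tcat a.2 b)
  end.

Fixpoint tmap (S : Type) (A B : S -> finType) (f : forall s, A s -> B s)
    (G : seq S) : tup A G -> tup B G :=
  match G return tup A G -> tup B G with
  | [::] => fun _ => tt
  | s :: G' => fun a => (f s a.1, tmap f a.2)
  end.

Fixpoint tall (S : Type) (A : S -> finType) (P : forall s, A s -> bool)
    (G : seq S) : tup A G -> bool :=
  match G return tup A G -> bool with
  | [::] => fun _ => true
  | s :: G' => fun a => P s a.1 && tall P a.2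
  end.

Fixpoint tall2 (S : Type) (A B : S -> finType) (P : forall s, A s -> B s -> bool)
    (G : seq S) : tup A G -> tup B G -> bool :=
  match G return tup A G -> tup B G -> bool with
  | [::] => fun _ _ => true
  | s :: G' => fun a b => P s a.1 b.1 && tall2 P a.2 b.2
  end.

(* Concatenation of a tuple of tuples. *)
Fixpoint tflat (S T : Type) (A : S -> finType) (f : T -> seq S) (G : seq T) :
    tup (fun t => tup A (f t)) G -> tup A (flatten (map f G)) :=
  match G return tup (fun t => tup A (f t)) G -> tup A (flatten (map f G)) with
  | [::] => fun _ => tt
  | t :: G' => fun a => tcat a.1 (tflat a.2)
  end.

(* Typed de Bruijn variables: [var G s] are the positions of sort s in G. *)
Inductive var (S : Type) : seq S -> S -> Type :=
| VZ s G : var (s :: G) s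
| VS s t G : var G s -> var (t :: G) s.

Fixpoint vars (S : Type) (G H : seq S) : Type :=
  if H is s :: H' then (var G s * vars G H')%type else unit.

Fixpoint lookup (S : Type) (A : S -> finType) (G : seq S) (s : S)
    (x : var G s) : tup A G -> A s :=
  match x in var G s return tup A G -> A s with
  | VZ _ _ => fun a => a.1
  | VS _ _ _ x' => fun a => lookup x' a.2
  end.

Fixpoint lookups (S : Type) (A : S -> finType) (G H : seq S) :
    vars G H -> tup A G -> tup A H :=
  match H return vars G H -> tup A G -> tup A H with
  | [::] => fun _ _ => tt
  | s :: H' => fun x a => (lookup x.1 a, lookups x.2 a)
  end.

(* [formula L G]: parameter-free L-formulas whose free variables have the sorts
   listed in the context G. *)
Inductive formula (L : language) : seq (lsort L) -> Type :=
| FFalse G : formula G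
| FEq G s (x y : var G s) : formula G
| FRel G (P : lrel L) (x : vars G (larity P)) : formula G
| FImp G (f g : formula G) : formula G
| FAll G s (f : formula (s :: G)) : formula G.

Record structure (L : language) := Structure {
  carrier :> lsort L -> finType;
  interp : forall P : lrel L, tup carrier (larity P) -> bool }.

Definition ssize (L : language) (M : structure L) : nat :=
  (\sum_(s : lsort L) #|M s|)%N.

Fixpoint sat (L : language) (M : structure L) (G : seq (lsort L))
    (f : formula G) : tup M G -> bool :=
  match f in formula G return tup M G -> bool with
  | FFalse _ => fun _ => false
  | FEq _ _ x y => fun a => lookup x a == lookup y a
  | FRel _ P x => fun a => interp (lookups x a)
  | FImp _ f g => fun a => sat f a ==> sat g a
  | FAll _ s f => fun a => [forall b : M s, sat f (b, a)]
  end.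

Definition is_isomorphism (L : language) (A B : structure L)
    (f : forall s, A s -> B s) : Prop :=
  (forall s, bijective (f s)) /\
  (forall (P : lrel L) (a : tup A (larity P)), interp a = interp (tmap f a)).

Definition member (L : language) (C : structure L -> Prop) : Type :=
  {M : structure L | C M}.

Definition uniform_littleo (R : realType) (T : Type) (Phi : T -> Prop)
    (sz : T -> nat) (f g : T -> R) : Prop :=
  forall eps : R, 0 < eps -> exists Q : nat, forall x : T,
    Phi x -> (Q < sz x)%N -> `|f x| <= eps * g x.

Definition admissible (R : realType) (K : nat) (p : nat * R) : Prop :=
  ((p.1 <= K)%N /\ 0 < p.2) \/ p = (0%N, 0).

Definition dimpow (R : realType) (N d n : nat) : R :=
  n%:R `^ (d%:R / N%:R).

Definition pointed (L : language) (G : seq (lsort L)) : Type :=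
  {M : structure L & tup M G}.

(* |phi(M; a)|, where the object variable is the first variable of phi. *)
Definition fiber_size (L : language) (s : lsort L) (G : seq (lsort L))
    (phi : formula (s :: G)) (x : pointed G) : nat :=
  #|[set b : projT1 x s | sat phi (b, projT2 x)]|.

(* For p = (d, mu) the estimate is |phi(M; a)| = mu |M|^{d/N} + o(|M|^{d/N}),
   uniformly on the cell of p; for (0, 0) it reads |phi(M; a)| = o(1). *)
Definition asymptotic_cells (R : realType) (N : nat) (L : language)
    (C : structure L -> Prop) (s : lsort L) (G : seq (lsort L))
    (phi : formula (s :: G)) (D : seq (nat * R))
    (cell : nat * R -> pointed G -> Prop) : Prop :=
  [/\ forall p, p \in D -> admissible N p,
      forall x : pointed G, C (projT1 x) -> exists! p, p \in D /\ cell p x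
    & forall p, p \in D ->
        uniform_littleo (fun x => C (projT1 x) /\ cell p x)
          (fun x => ssize (projT1 x))
          (fun x => (fiber_size phi x)%:R
                    - p.2 * dimpow R N p.1 (ssize (projT1 x)))
          (fun x => dimpow R N p.1 (ssize (projT1 x)))].

Definition asymptotic_class (R : realType) (N : nat) (L : language)
    (C : structure L -> Prop) : Prop :=
  (0 < N)%N /\
  forall (s : lsort L) (G : seq (lsort L)) (phi : formula (s :: G)),
  exists (D : seq (nat * R)) (theta : nat * R -> formula G),
    asymptotic_cells N C phi D (fun p x => sat (theta p) (projT2 x)).

Definition weak_asymptotic_class (R : realType) (N : nat) (L : language)
    (C : structure L -> Prop) : Prop :=
  (0 < N)%N /\
  forall (s : lsort L) (G : seq (lsort L)) (phi : formula (s :: G)),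
  exists (D : seq (nat * R)) (cell : nat * R -> pointed G -> Prop),
    asymptotic_cells N C phi D cell.

(* The formulas of an interpretation of arity r. Each sort t of L' is
   interpreted by a quotient of a definable set of r-tuples, whose coordinates
   have the sorts [uctx t]; the parameters have the sorts [zctx]. *)
Record scheme (L L' : language) (r : nat) := Scheme {
  zctx : seq (lsort L);
  uctx : lsort L' -> seq (lsort L);
  size_uctx : forall t, size (uctx t) = r;
  delta : forall t, formula (uctx t ++ zctx);
  epsilon : forall t, formula (uctx t ++ (uctx t ++ zctx));
  relform : forall P : lrel L',
    formula (flatten (map uctx (larity P)) ++ zctx) }.

Definition udom (L L' : language) (r : nat) (I : scheme L L' r)
    (M : structure L) (c : tup M (zctx I)) (t : lsort L') :
    {set tup M (uctx I t)} :=
  [set u | sat (delta I t) (tcat u c)].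

Definition ueqv (L L' : language) (r : nat) (I : scheme L L' r)
    (M : structure L) (c : tup M (zctx I)) (t : lsort L')
    : rel (tup M (uctx I t)) :=
  fun u v => sat (epsilon I t) (tcat u (tcat v c)).

Definition urel (L L' : language) (r : nat) (I : scheme L L' r)
    (M : structure L) (c : tup M (zctx I)) (P : lrel L')
    (u : tup (fun t => tup M (uctx I t)) (larity P)) : bool :=
  sat (relform I P) (tcat (tflat u) c).

Definition well_defined (L L' : language) (r : nat) (I : scheme L L' r)
    (M : structure L) (c : tup M (zctx I)) : Prop :=
  (forall t, {in udom c t & &, equivalence_rel (ueqv c (t := t))}) /\
  (forall (P : lrel L') (u v : tup (fun t => tup M (uctx I t)) (larity P)),
     tall (fun t x => x \in udom c t) u ->
     tall (fun t x => x \in udom c t) v ->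
     tall2 (ueqv c) u v -> urel c u = urel c v).

Definition class_of (L L' : language) (r : nat) (I : scheme L L' r)
    (M : structure L) (c : tup M (zctx I)) (t : lsort L') : finType :=
  {B : {set tup M (uctx I t)}
     | B \in equivalence_partition (ueqv c (t := t)) (udom c t)} : finType.

Definition in_class (L L' : language) (r : nat) (I : scheme L L' r)
    (M : structure L) (c : tup M (zctx I)) (t : lsort L')
    (u : tup M (uctx I t)) (B : class_of c t) : bool :=
  u \in sval B.

(* X_A / E_A as an L'-structure: elements are equivalence classes, and a
   relation holds if the formula holds of some (equivalently, under
   [well_defined], all) representatives. *)
Definition quotient (L L' : language) (r : nat) (I : scheme L L' r)
    (M : structure L) (c : tup M (zctx I)) : structure L' :=
  @Structure L' (class_of c)
    (fun P b => [exists u : tup (fun t => tup M (uctx I t)) (larity P),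
                   tall2 (in_class (c := c)) u b && urel c u]).

Record uniform_interpretation (L L' : language) (C : structure L -> Prop)
    (D : structure L' -> Prop) (r : nat) := UniformInterpretation {
  ui_arity_gt0 : (0 < r)%N;
  ui_scheme :> scheme L L' r;
  ui_alpha : member D -> member C;
  ui_alpha_inj : injective ui_alpha;
  ui_param : forall A : member D, tup (sval (ui_alpha A)) (zctx ui_scheme);
  ui_well_defined : forall A : member D, well_defined (ui_param A);
  ui_iota : forall (A : member D) (t : lsort L'),
    sval A t -> quotient (ui_param A) t;
  ui_iota_iso : forall A : member D, is_isomorphism (@ui_iota A) }.

Definition size_cell (R : realType) (L L' : language)
    (C : structure L -> Prop) (D : structure L' -> Prop) (r : nat)
    (I : uniform_interpretation C D r) (chi : nat * R -> formula (zctx I))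
    (p : nat * R) (A : member D) : Prop :=
  sat (chi p) (ui_param I A).

Definition size_partition (R : realType) (L L' : language)
    (C : structure L -> Prop) (D : structure L' -> Prop) (N r : nat)
    (I : uniform_interpretation C D r)
    (F : seq (nat * R)) (chi : nat * R -> formula (zctx I)) : Prop :=
  let sz (A : member D) := ssize (sval (ui_alpha I A)) in
  [/\ forall p, p \in F -> admissible (N * r) p,
      forall A : member D, exists! p, p \in F /\ size_cell chi p A
    & forall p, p \in F ->
        uniform_littleo (size_cell chi p) sz
          (fun A => (ssize (sval A))%:R - p.2 * dimpow R N p.1 (sz A))
          (fun A => dimpow R N p.1 (sz A))].

Definition unbounded_exponent (R : realType) (L L' : language)
    (C : structure L -> Prop) (D : structure L' -> Prop) (r : nat)
    (I : uniform_interpretation C D r)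
    (F : seq (nat * R)) (chi : nat * R -> formula (zctx I)) (e : nat) : Prop :=
  (0 < e)%N /\ exists lambda : R,
    [/\ 0 < lambda, (e, lambda) \in F
      & forall B : nat, exists A : member D,
          size_cell chi (e, lambda) A /\ (B < ssize (sval A))%N].

(* The exponents occurring in a [size_partition] are at most N * r. *)
Definition LQ (R : realType) (L L' : language)
    (C : structure L -> Prop) (D : structure L' -> Prop) (N r : nat)
    (I : uniform_interpretation C D r)
    (F : seq (nat * R)) (chi : nat * R -> formula (zctx I)) : nat :=
  (\big[lcmn/1]_(0 <= e < (N * r).+1 | `[< unbounded_exponent F chi e >]) e)%N.

(* Main.v *)
Require Import Defs.
From mathcomp Require Import all_boot all_order all_algebra.
From mathcomp Require Import reals.
From mathcomp Require Import boolp exp ring lra.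

(* The number of tuples satisfying a formula has finitely many asymptotics
   mu |M|^(d/N), on definable cells, by induction on the length of the tuples
   (Fubini).  The number of classes of a definable equivalence relation is the
   sum over the tuples of 1 / (size of the class of the tuple); splitting this
   sum along the cells of the class size gives the same result for quotients.
   Pulling an L'-formula back to L along the interpretation, one obtains
   |phi(A; b)| ~ mu |M|^(d/N) and |A| ~ lam |M|^(e/N), with M = alpha(A), hence
   |phi(A; b)| ~ mu lam^(-d/e) |A|^(d/e), and d/e has denominator dividing any
   multiple of e.  When |A| is unbounded on the size cell, e is positive; the
   other size cells contain only small structures, and there nothing is to be
   proved. *)

Set Implicit Arguments.
Unset Strict Implicit.
Unset Printing Implicit Defensive.

Import Order.TTheory GRing.Theory Num.Theory.

Local Open Scope ring_scope.

(** * Tuple maps that only rearrange coordinates *)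

Section Selectors.
Variable S : Type.
Implicit Types G H K : seq S.

Fixpoint tleft (A : S -> finType) G H : tup A (G ++ H) -> tup A G :=
  match G return tup A (G ++ H) -> tup A G with
  | [::] => fun _ => tt
  | s :: G' => fun a => (a.1, tleft a.2)
  end.

Fixpoint tright (A : S -> finType) G H : tup A (G ++ H) -> tup A H :=
  match G return tup A (G ++ H) -> tup A H with
  | [::] => fun a => a
  | s :: G' => fun a => tright a.2
  end.

Lemma tleft_tcat (A : S -> finType) G H (u : tup A G) (a : tup A H) :
  tleft (tcat u a) = u.
Proof. by elim: G u => [[]|s G IH [b u]] //=; rewrite IH. Qed.

Lemma tright_tcat (A : S -> finType) G H (u : tup A G) (a : tup A H) :
  tright (tcat u a) = a.
Proof. by elim: G u => [|s G IH] //= [b u] /=; rewrite IH. Qed.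

(** The variables [y] are chosen before the family [A], so composition with [f] is a renaming of
    variables valid in all structures at once. *)
Definition selector G H (f : forall A : S -> finType, tup A G -> tup A H) : Prop :=
  exists y : vars G H, forall A (a : tup A G), lookups y a = f A a.

Lemma selector_lookups G H (y : vars G H) : selector (fun A => @lookups S A G H y).
Proof. by exists y. Qed.

Lemma var_select G H s (x : var H s) (y : vars G H) :
  exists z : var G s, forall A (a : tup A G), lookup z a = lookup x (lookups y a).
Proof.
elim: x y => [{}s K|{}s t K x IH] /= y; first by exists y.1.
by have [z zE] := IH y.2; exists z.
Qed.

Lemma selector_comp G H K (f : forall A : S -> finType, tup A G -> tup A H)
    (g : forall A : S -> finType, tup A H -> tup A K) :
  selector f -> selector g -> selector (fun A a => g A (f A a)).
Proof.
move=> [y yE] [z zE].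
suff [w wE] : exists w : vars G K, forall A (a : tup A G),
    lookups w a = lookups z (lookups y a).
  by exists w => A a; rewrite wE yE zE.
elim: K {g zE} z => [|s K IH] /= z; first by exists tt.
have [w wE] := IH z.2; have [x xE] := var_select z.1 y.
by exists (x, w) => A a /=; rewrite wE xE.
Qed.

Lemma vars_weaken G H t (y : vars G H) :
  exists z : vars (t :: G) H, forall A (a : tup A (t :: G)),
    lookups z a = lookups y a.2.
Proof.
elim: H y => [|s H IH] /= y; first by exists tt.
by have [z zE] := IH y.2; exists (VS t y.1, z) => A a /=; rewrite zE.
Qed.

Lemma selector_id G : selector (fun A (a : tup A G) => a).
Proof.
elim: G => [|s G [y yE]]; first by exists tt => A [].
have [z zE] := vars_weaken s y.
by exists (VZ s G, z) => A [b a] /=; rewrite zE yE.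
Qed.

Lemma selector_tail G s : selector (fun A (a : tup A (s :: G)) => a.2).
Proof.
have [y yE] := selector_id G; have [z zE] := vars_weaken s y.
by exists z => A a; rewrite zE yE.
Qed.

Lemma selector_tcat G H K (f : forall A : S -> finType, tup A G -> tup A H)
    (g : forall A : S -> finType, tup A G -> tup A K) :
  selector f -> selector g -> selector (fun A a => tcat (f A a) (g A a)).
Proof.
move=> [y yE] [z zE].
suff [w wE] : exists w : vars G (H ++ K), forall A (a : tup A G),
    lookups w a = tcat (lookups y a) (lookups z a).
  by exists w => A a; rewrite wE yE zE.
elim: H {f yE} y => [|s H IH] /= y; first by exists z.
by have [w wE] := IH y.2; exists (y.1, w) => A a /=; rewrite wE.
Qed.

Lemma selector_lift s G H (f : forall A : S -> finType, tup A G -> tup A H) :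
  selector f -> selector (fun A (a : tup A (s :: G)) => (a.1, f A a.2) : tup A (s :: H)).
Proof.
move=> /(selector_comp (selector_tail G s)) [y yE].
by exists (VZ s G, y) => A a /=; rewrite yE.
Qed.

Lemma selector_tleft G H : selector (fun A (a : tup A (G ++ H)) => tleft a).
Proof.
elim: G => [|s G IH]; first by exists tt.
exact: (selector_lift s IH).
Qed.

Lemma selector_tright G H : selector (fun A (a : tup A (G ++ H)) => tright a).
Proof.
elim: G => [|s G IH]; first exact: selector_id.
exact: selector_comp (selector_tail _ _) IH.
Qed.

End Selectors.

(** * Closure properties of definable predicates *)

Section Definability.
Variable L : language.
Local Notation sort := (lsort L).
Implicit Types G H : seq sort.

Definition FNot G (f : formula G) := FImp f (FFalse G).
Definition FOr G (f g : formula G) := FImp (FNot f) g.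

Lemma sat_FNot (M : structure L) G (f : formula G) (a : tup M G) :
  sat (FNot f) a = ~~ sat f a.
Proof. by rewrite /= implybF. Qed.

Lemma sat_FOr (M : structure L) G (f g : formula G) (a : tup M G) :
  sat (FOr f g) a = sat f a || sat g a.
Proof. by rewrite /= implybF; case: (sat f a). Qed.

Lemma sat_bigFOr (M : structure L) G (J : finType) (P : pred J)
    (f : J -> formula G) (a : tup M G) :
  sat (\big[@FOr G/FFalse G]_(j | P j) f j) a = [exists (j | P j), sat (f j) a].
Proof.
rewrite (big_morph (fun g => sat g a) (id1 := false) (op1 := orb)) ?big_orE //.
by move=> g h; rewrite sat_FOr.
Qed.

Definition definable G (P : forall M : structure L, tup M G -> bool) : Prop :=
  exists f : formula G, forall M a, sat f a = P M a.

Lemma definable_sat G (f : formula G) : definable (fun M => @sat L M G f).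
Proof. by exists f. Qed.

Lemma definable_eq G (P Q : forall M : structure L, tup M G -> bool) :
  (forall M a, P M a = Q M a) -> definable P -> definable Q.
Proof. by move=> PQ [f fE]; exists f => M a; rewrite fE PQ. Qed.

Lemma definable_not G (P : forall M : structure L, tup M G -> bool) :
  definable P -> definable (fun M a => ~~ P M a).
Proof. by move=> [f fE]; exists (FNot f) => M a; rewrite sat_FNot fE. Qed.

Lemma definable_imp G (P Q : forall M : structure L, tup M G -> bool) :
  definable P -> definable Q -> definable (fun M a => P M a ==> Q M a).
Proof. by move=> [f fE] [g gE]; exists (FImp f g) => M a; rewrite /= fE gE. Qed.

Lemma definable_and G (P Q : forall M : structure L, tup M G -> bool) :
  definable P -> definable Q -> definable (fun M a => P M a && Q M a).
Proof.
move=> dP dQ; apply: definable_eq (definable_not (definable_imp dP (definable_not dQ))).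
by move=> M a; rewrite negb_imply negbK.
Qed.

Lemma definable_all G H (P : forall M : structure L, tup M (H ++ G) -> bool) :
  definable P ->
  definable (fun M a => [forall u : tup M H, P M (tcat u a)]).
Proof.
move=> [f fE].
suff [g gE] : exists g : formula G, forall (M : structure L) (a : tup M G),
    sat g a = [forall u : tup M H, sat f (tcat u a)].
  by exists g => M a; rewrite gE; apply: eq_forallb => u; rewrite fE.
elim: H f {P fE} => [|s H IH] f.
  by exists f => M a; apply/idP/forallP => [fa []|/(_ tt)].
(* The first coordinate is quantified innermost, which leaves a formula in the context [H ++ G] for
   the induction hypothesis. *)
have [g gE] := IH (FAll f); exists g => M a; rewrite gE.
apply/forallP/forallP => [fa [b u]|fa u] /=; first by have /forallP := fa u; apply.
by apply/forallP => b; apply: (fa (b, u)).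
Qed.

Lemma formula_select G H (f : formula H) (y : vars G H) :
  exists g : formula G, forall (M : structure L) (a : tup M G),
    sat g a = sat f (lookups y a).
Proof.
elim: f G y => {H} [H|H s x1 x2|H P x|H f IHf g IHg|H s f IHf] G y.
- by exists (FFalse G).
- have [z1 z1E] := var_select x1 y; have [z2 z2E] := var_select x2 y.
  by exists (FEq z1 z2) => M a /=; rewrite z1E z2E.
- have [z zE] := selector_comp (selector_lookups y) (selector_lookups x).
  by exists (FRel z) => M a /=; rewrite zE.
- have [f' fE] := IHf G y; have [g' gE] := IHg G y.
  by exists (FImp f' g') => M a /=; rewrite fE gE.
- have [z zE] := selector_lift s (selector_lookups y).
  have [g gE] := IHf _ z; exists (FAll g) => M a /=.
  by apply: eq_forallb => b; rewrite gE zE.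
Qed.

Lemma definable_select G H (f : forall A : sort -> finType, tup A G -> tup A H)
    (P : forall M : structure L, tup M H -> bool) :
  definable P -> selector f -> definable (fun M a => P M (f M a)).
Proof.
move=> [g gE] [y yE]; have [h hE] := formula_select g y.
by exists h => M a; rewrite hE yE gE.
Qed.

Lemma sat_isomorphism (A B : structure L) (f : forall s, A s -> B s) G
    (phi : formula G) (a : tup A G) :
  is_isomorphism f -> sat phi (tmap f a) = sat phi a.
Proof.
move=> [bij_f f_interp].
have lookupE H s (x : var H s) (b : tup A H) : lookup x (tmap f b) = f s (lookup x b).
  by elim: x b => //= t s' K x IH b; rewrite IH.
elim: phi a => {G} [G|G s x y|G P x|G p IHp q IHq|G s p IHp] a //=.
- rewrite !lookupE; exact: (inj_eq (bij_inj (bij_f s))).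
- rewrite f_interp; congr (interp _).
  by elim: (larity P) x => //= s K IH [x1 x2] /=; rewrite lookupE IH.
- by rewrite IHp IHq.
- apply/forallP/forallP => [pa b|pa b]; first by rewrite -IHp; apply: (pa (f s b)).
  have [g fK gK] := bij_f s; rewrite -(gK b).
  by have := pa (g b); rewrite -IHp.
Qed.

End Definability.

(** * Calculus of leading terms *)

Section Asymptotics.
Variables (R : realType) (N : nat) (T : Type) (sz : T -> nat).
Hypothesis N_gt0 : (0 < N)%N.
Implicit Types (W P Q : T -> Prop) (f g : T -> R) (p q : nat * R).

Local Notation root x := (dimpow R N 1 (sz x)).

(** The threshold [B] is common to all of [W]: this is the uniformity of the little-o. *)
Definition for_large W P : Prop :=
  exists B : nat, forall x, W x -> (B < sz x)%N -> P x.

Lemma for_large_mono W P Q :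
  for_large W P -> (forall x, W x -> P x -> Q x) -> for_large W Q.
Proof. by move=> [B PB] PQ; exists B => x Wx /(PB x Wx); apply: PQ. Qed.

Lemma for_large_and W P Q :
  for_large W P -> for_large W Q -> for_large W (fun x => P x /\ Q x).
Proof.
move=> [B PB] [B' QB]; exists (maxn B B') => x Wx.
by rewrite gtn_max => /andP[/(PB x Wx) Px /(QB x Wx)].
Qed.

Lemma for_large_all (J : finType) W (P : J -> T -> Prop) :
  (forall j, for_large W (P j)) -> for_large W (fun x => forall j, P j x).
Proof.
move=> /choice[B PB]; exists (\max_j B j) => x Wx B_lt j.
by apply: (PB j x Wx); apply: leq_ltn_trans B_lt; apply: leq_bigmax.
Qed.

(** Turns every power of |M| into a natural power of the root |M|^(1/N), so that the estimates below
    become polynomial in that root. *)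
Lemma dimpowE d n : dimpow R N d n = dimpow R N 1 n ^+ d.
Proof.
by rewrite /dimpow mul1r mulrC powRrM powR_mulrn // powR_ge0.
Qed.

Lemma dimpow_ge0 K d n : 0 <= dimpow R K d n.
Proof. exact: powR_ge0. Qed.

Lemma for_large_root W (b : R) : for_large W (fun x => b <= root x).
Proof.
have [b_le0|b_gt0] := leP b 0.
  by exists 0%N => x _ _; apply: le_trans b_le0 (dimpow_ge0 _ _ _).
have bN_ge0 : 0 <= b ^+ N by apply: exprn_ge0; apply: ltW.
exists (Num.bound (b ^+ N)) => x _ x_large.
rewrite -(@ler_pXn2r _ N) ?nnegrE ?dimpow_ge0 ?ltW //.
rewrite -dimpowE /dimpow divff ?pnatr_eq0 -?lt0n // powRr1 ?ler0n //.
have := archi_boundP bN_ge0; move/lt_trans; apply; by rewrite ltr_nat.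
Qed.

Definition approx W f p : Prop :=
  uniform_littleo W sz (fun x => f x - p.2 * dimpow R N p.1 (sz x))
    (fun x => dimpow R N p.1 (sz x)).

Lemma approxP W f p : approx W f p <-> forall e : R, 0 < e ->
  for_large W (fun x => `|f x - p.2 * root x ^+ p.1| <= e * root x ^+ p.1).
Proof.
by split=> fp e e_gt0; have [B fB] := fp e e_gt0; exists B => x Wx /(fB x Wx);
  rewrite (dimpowE p.1).
Qed.

Lemma approx_eventually_eq W f g p :
  approx W f p -> for_large W (fun x => f x = g x) -> approx W g p.
Proof.
move=> /approxP fp fg; apply/approxP => e /fp fpe.
by apply: for_large_mono (for_large_and fpe fg) _ => x _ [+ <-].
Qed.

Lemma approx_sub W P f p : (forall x, P x -> W x) -> approx W f p -> approx P f p.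
Proof. by move=> PW fp e e_gt0; have [B fB] := fp e e_gt0; exists B => x /PW; apply: fB. Qed.

(** The leading term of a sum of functions with leading terms [p] and [q]; admissible coefficients
    are nonnegative, so they cannot cancel. *)
Definition oplus p q : nat * R :=
  if (p.1 < q.1)%N then q else if (q.1 < p.1)%N then p else (p.1, p.2 + q.2).

(** With y = |M|^(1/N), [f] is at most (1 + |p.2|) y^(p.1) in absolute value, and y^(q.1) is at
    least y times y^(p.1) when y >= 1. So [f] takes at most half of the allowed error once y >= (1 +
    |p.2|) / (e / 2). *)
Lemma approx_absorb W f g p q : (p.1 < q.1)%N ->
  approx W f p -> approx W g q -> approx W (fun x => f x + g x) q.
Proof.
move=> pq /approxP fp /approxP gq; apply/approxP => e e_gt0.
have e2 : 0 < e / 2 by lra.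
apply: for_large_mono (for_large_and (for_large_root W 1) (for_large_and
  (for_large_root W ((1 + `|p.2|) / (e / 2)))
  (for_large_and (fp 1 ltr01) (gq _ e2)))) _ => x _ [+ [+ []]].
set y := root x; set m := y ^+ p.1; set k := y ^+ q.1 => y1 yb fm gm.
have m_ge0 : 0 <= m by rewrite exprn_ge0 // dimpow_ge0.
have ymk : y * m <= k by rewrite -exprS ler_weXn2l.
have pm : `|p.2 * m| = `|p.2| * m by rewrite normrM (ger0_norm m_ge0).
have f_le : `|f x| <= (1 + `|p.2|) * m.
  rewrite -(subrK (p.2 * m) (f x)); apply: le_trans (ler_normD _ _) _.
  by rewrite pm; lra.
have fk : (1 + `|p.2|) * m <= e / 2 * k.
  rewrite ler_pdivrMr // in yb; rewrite [_ / 2 * k]mulrC.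
  apply: le_trans (ler_wpM2r m_ge0 yb) _.
  by rewrite mulrAC ler_wpM2r // ltW.
rewrite -addrA; apply: le_trans (ler_normD _ _) _.
by apply: le_trans (lerD f_le gm) _; lra.
Qed.

Lemma approx_add W f g p q :
  approx W f p -> approx W g q -> approx W (fun x => f x + g x) (oplus p q).
Proof.
move=> fp gq; rewrite /oplus; have [pq|qp|pq] := ltngtP p.1 q.1.
- exact: approx_absorb fp gq.
- apply: approx_eventually_eq (approx_absorb qp gq fp) _.
  by exists 0%N => x _ _; rewrite addrC.
move/approxP: fp => fp; move/approxP: gq => gq; apply/approxP => e e_gt0.
have e2 : 0 < e / 2 by lra.
apply: for_large_mono (for_large_and (fp _ e2) (gq _ e2)) _ => x _ /= [].
rewrite -pq; set m := _ ^+ _ => fm gm.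
have -> : f x + g x - (p.2 + q.2) * m = (f x - p.2 * m) + (g x - q.2 * m) by ring.
by apply: le_trans (ler_normD _ _) _; lra.
Qed.

Lemma admissible_oplus K p q :
  admissible K p -> admissible K q -> admissible K (oplus p q).
Proof.
rewrite /oplus => pa qa; case: ltngtP => // pq.
by case: pa qa pq => [[pK p_gt0]|->] [[qK q_gt0]|->] //= pq;
  [left|left|left|right]; rewrite ?addr0 ?add0r ?addr_gt0 -?pq.
Qed.

Lemma admissible_ge0 K p : admissible K p -> 0 <= p.2.
Proof. by case=> [[_ /ltW]|->]. Qed.

(** A natural number at distance at most 1/2 from 0 is 0; hence on a cell of value (0, 0) a count
    vanishes exactly in all large structures. *)
Lemma approx_nat0 W (h : T -> nat) :
  approx W (fun x => (h x)%:R) (0%N, 0) -> for_large W (fun x => h x = 0%N).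
Proof.
move=> /approxP/(_ (2^-1)); rewrite invr_gt0 ltr0n => /(_ isT) hp.
apply: for_large_mono hp _ => x _ /=; rewrite mul0r subr0 expr0 mulr1.
rewrite normr_nat; case: (h x) => // n; rewrite -natr1 => n_le.
by suff: false by []; have := ler0n R n; lra.
Qed.

Lemma approx0 W f : for_large W (fun x => f x = 0) -> approx W f (0%N, 0).
Proof.
move=> f0; apply/approxP => e e_gt0; apply: for_large_mono f0 _ => x _ ->.
by rewrite /= mul0r subrr normr0 mulr1 ltW.
Qed.

(* [m] is the scale of the summands, [k] that of their number. *)
Lemma approx_sumE (I : finType) (A : {set I}) (h : I -> R) (mu m nu k e : R) :
  0 <= m -> 0 <= k -> 0 < e <= 1 -> 0 <= mu -> 0 <= nu ->
  (forall i, i \in A -> `|h i - mu * m| <= e * m) ->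
  `|#|A|%:R - nu * k| <= e * k ->
  `|\sum_(i in A) h i - nu * mu * (k * m)| <= e * (nu + mu + 1) * (k * m).
Proof.
move=> m_ge0 k_ge0 /andP[e_gt0 e_le1] mu_ge0 nu_ge0 hm Ak.
have sum_le : `|\sum_(i in A) h i - #|A|%:R * (mu * m)| <= #|A|%:R * (e * m).
  rewrite !mulr_natl -!sumr_const -sumrB; apply: le_trans (ler_norm_sum _ _ _) _.
  exact: ler_sum.
have A_le : #|A|%:R <= (nu + 1) * k.
  move: Ak; rewrite ler_norml => /andP[_]; have := ler_wpM2r k_ge0 e_le1; lra.
have -> : \sum_(i in A) h i - nu * mu * (k * m) =
  (\sum_(i in A) h i - #|A|%:R * (mu * m)) + (#|A|%:R - nu * k) * (mu * m) by ring.
apply: le_trans (ler_normD _ _) _.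
rewrite [`|_ * (mu * m)|]normrM (ger0_norm (mulr_ge0 mu_ge0 m_ge0)).
have em_ge0 : 0 <= e * m by rewrite mulr_ge0 // ltW.
have := ler_wpM2r em_ge0 A_le.
have := ler_wpM2r (mulr_ge0 mu_ge0 m_ge0) Ak.
by lra.
Qed.

(** Here [h] is at least mu m / 2, and 1/h - 1/(mu m) equals (mu m - h) / (h mu m). *)
Lemma inv_approx (h mu m e : R) : 0 < m -> 0 < mu -> 0 < e -> e <= mu / 2 ->
  `|h - mu * m| <= e * m -> `|h^-1 - mu^-1 * m^-1| <= e * (2 / mu ^+ 2) * m^-1.
Proof.
move=> m_gt0 mu_gt0 e_gt0 e_le hm.
have h_ge : mu * m / 2 <= h.
  move: hm; rewrite ler_norml => /andP[+ _]; have := ler_wpM2r (ltW m_gt0) e_le; lra.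
have mm_gt0 : 0 < mu * m by rewrite mulr_gt0.
have h_gt0 : 0 < h by lra.
have -> : h^-1 - mu^-1 * m^-1 = (mu * m - h) * (h^-1 / (mu * m)).
  by field; rewrite !gt_eqF.
rewrite normrM distrC (@ger0_norm _ (_^-1 / _)); last first.
  by rewrite ltW // divr_gt0 ?invr_gt0.
have hV_le : h^-1 <= 2 / (mu * m).
  by rewrite -[2 / _]invf_div lef_pV2 ?posrE // divr_gt0.
apply: le_trans (ler_wpM2r _ hm) _; first by rewrite ltW // divr_gt0 ?invr_gt0.
have -> : e * (2 / mu ^+ 2) * m^-1 = e * m * (2 / (mu * m) / (mu * m)).
  by field; rewrite !gt_eqF.
by rewrite ler_pM2l ?mulr_gt0 // ler_pM2r ?invr_gt0.
Qed.

End Asymptotics.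

(** * Functions whose asymptotics are given on definable cells *)

Section DefinableAsymptotics.
Variables (R : realType) (N : nat) (L : language) (C : structure L -> Prop).
Hypothesis N_gt0 : (0 < N)%N.
Implicit Types (G H : seq (lsort L)) (K : nat).

Definition psize G (x : pointed G) : nat := ssize (projT1 x).

Definition extend G H (x : pointed G) (u : tup (projT1 x) H) : pointed (H ++ G) :=
  existT (fun M : structure L => tup M (H ++ G)) (projT1 x) (tcat u (projT2 x)).

Arguments extend [G H] x u.

Definition solutions G H (phi : formula (H ++ G)) (x : pointed G) :
    {set tup (projT1 x) H} :=
  [set u | sat phi (projT2 (extend x u))].

Local Notation root x := (dimpow R N 1 (psize x)).

(** Real values accommodate the sums of inverses. Indexing the cells by a finite type rather than by
    their values lets several cells share a value, so that refinements need no merging. *)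
Definition definable_asymptotics K G (f : pointed G -> R) : Prop :=
  exists (J : finType) (theta : J -> formula G) (v : J -> nat * R),
  [/\ forall j, admissible K (v j),
      forall x : pointed G, C (projT1 x) -> exists! j, sat (theta j) (projT2 x)
    & forall j, approx N (@psize G)
        (fun x : pointed G => C (projT1 x) /\ sat (theta j) (projT2 x)) f (v j)].

Lemma definable_asymptotics_eq K G (f g : pointed G -> R) :
  (forall x, C (projT1 x) -> f x = g x) ->
  definable_asymptotics K f -> definable_asymptotics K g.
Proof.
move=> fg [J [theta [v [vK cover est]]]]; exists J, theta, v; split=> // j.
by apply: approx_eventually_eq (est j) _; exists 0%N => x [Cx _] _; rewrite fg.
Qed.

Lemma definable_asymptotics_eq0 K G (f : pointed G -> R) :
  for_large (@psize G) (fun x => C (projT1 x)) (fun x => f x = 0) ->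
  definable_asymptotics K f.
Proof.
case=> B f0; exists unit, (fun=> FNot (FFalse G)), (fun=> (0%N, 0)).
split=> [_|x Cx|_]; first by right.
  by exists tt; split=> [|[]].
by apply: approx0; exists B => x [Cx _]; apply: f0.
Qed.

Lemma definable_asymptotics_add K G (f g : pointed G -> R) :
  definable_asymptotics K f -> definable_asymptotics K g ->
  definable_asymptotics K (fun x => f x + g x).
Proof.
move=> [J [theta [v [vK cover est]]]] [J' [theta' [v' [vK' cover' est']]]].
have /choice[t tE] (j : J * J') : definable (fun (M : structure L) (a : tup M G) =>
    sat (theta j.1) a && sat (theta' j.2) a).
  by apply: definable_and; apply: definable_sat.
exists (J * J')%type, t, (fun j => oplus (v j.1) (v' j.2)); split=> [j|x Cx|j].
- exact: admissible_oplus.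
- have [j [xj uj]] := cover x Cx; have [j' [xj' uj']] := cover' x Cx.
  exists (j, j'); split=> [|[i i']]; rewrite tE /=; first by rewrite xj xj'.
  by move=> /andP[/uj-> /uj'->].
- apply: approx_add => //.
    by apply: approx_sub (est j.1) => x [Cx]; rewrite tE => /andP[].
  by apply: approx_sub (est' j.2) => x [Cx]; rewrite tE => /andP[].
Qed.

Lemma definable_asymptotics_sum (I : finType) K G (f : I -> pointed G -> R) :
  (forall i, definable_asymptotics K (f i)) ->
  definable_asymptotics K (fun x => \sum_i f i x).
Proof.
move=> fK; elim: (index_enum I) => [|i s IH].
  by apply: definable_asymptotics_eq0; exists 0%N => x _ _; rewrite big_nil.
apply: definable_asymptotics_eq (definable_asymptotics_add (fK i) IH) => x _.
by rewrite big_cons.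
Qed.

(** Each [u] puts [extend x u] in exactly one cell, so after an exchange of summations the full sum
    is the sum over [j] of the partial sums. *)
Lemma definable_asymptotics_partition K G H (J : finType)
    (theta : J -> formula (H ++ G)) (h : pointed (H ++ G) -> R) :
  (forall z : pointed (H ++ G), C (projT1 z) -> exists! j, sat (theta j) (projT2 z)) ->
  (forall j, definable_asymptotics K
     (fun x : pointed G => \sum_(u in solutions (theta j) x) h (extend x u))) ->
  definable_asymptotics K (fun x => \sum_(u : tup (projT1 x) H) h (extend x u)).
Proof.
move=> cover est.
apply: definable_asymptotics_eq (definable_asymptotics_sum est) => x Cx.
under eq_bigr => j _ do rewrite big_mkcond.
rewrite exchange_big; apply: eq_bigr => u _; rewrite -big_mkcond /=.
have [j [uj jU]] := cover (extend x u) Cx.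
by rewrite (big_pred1 j) // => i; rewrite inE; apply/idP/eqP => [/jU->|->].
Qed.

(** The scale [m] is left arbitrary to cover both a power of |M| and the inverse of one. One
    threshold for [h] serves all [u], because [extend x u] lives in the same structure as [x]. *)
Lemma approx_sum_solutions G H (W : pointed G -> Prop) (T : formula (H ++ G))
    (h : pointed (H ++ G) -> R) (m : nat -> R) (mu : R) K (p : nat * R) :
  (forall n, 0 <= m n) -> 0 <= mu -> admissible K p ->
  (forall x, W x -> C (projT1 x)) ->
  approx N (@psize G) W (fun x => #|solutions T x|%:R) p ->
  (forall e, 0 < e -> for_large (@psize _)
     (fun z : pointed (H ++ G) => C (projT1 z) /\ sat T (projT2 z))
     (fun z => `|h z - mu * m (psize z)| <= e * m (psize z))) ->
  forall e, 0 < e -> for_large (@psize G) W (fun x =>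
    `|\sum_(u in solutions T x) h (extend x u)
      - p.2 * mu * (root x ^+ p.1 * m (psize x))|
    <= e * (root x ^+ p.1 * m (psize x))).
Proof.
move=> m_ge0 mu_ge0 pK WC /approxP Tp hm e e_gt0.
have p_ge0 := admissible_ge0 pK.
have s_gt0 : 0 < p.2 + mu + 1 by lra.
(* [approx_sumE] wants an error of at most 1 and multiplies it by p.2 + mu + 1. *)
pose e' := Num.min 1 (e / (p.2 + mu + 1)).
have e'_gt0 : 0 < e' by rewrite lt_min ltr01 divr_gt0.
have [B hB] := hm _ e'_gt0; have [B' TB] := Tp _ e'_gt0.
exists (maxn B B') => x Wx; rewrite gtn_max => /andP[Bx B'x].
have k_ge0 : 0 <= root x ^+ p.1 by rewrite exprn_ge0 // dimpow_ge0.
apply: le_trans (approx_sumE (m_ge0 _) k_ge0 (e := e') _ mu_ge0 p_ge0 _ (TB x Wx B'x)) _.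
- by rewrite e'_gt0 ge_min lexx.
- by move=> u; rewrite inE => uT; apply: hB => //; split=> //; apply: WC.
- by rewrite ler_wpM2r ?mulr_ge0 // -ler_pdivlMr // ge_min lexx orbT.
Qed.

Lemma definable_asymptotics_mul K K' G H (T : formula (H ++ G))
    (h : pointed (H ++ G) -> nat) (q : nat * R) :
  definable_asymptotics K (fun x : pointed G => #|solutions T x|%:R) ->
  admissible K' q ->
  approx N (@psize _) (fun z : pointed (H ++ G) => C (projT1 z) /\ sat T (projT2 z))
    (fun z => (h z)%:R) q ->
  definable_asymptotics (K + K')
    (fun x : pointed G => \sum_(u in solutions T x) (h (extend x u))%:R).
Proof.
move=> [J [theta [v [vK cover est]]]] qK' hq.
case: (qK') => [[q1K' q2_gt0]|q0].
(* If the number of solutions has value (0, 0), the sum is eventually empty and again has value (0,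
   0); exponent q.1 with coefficient 0 would not be admissible in general. *)
- exists J, theta, (fun j => if (v j).2 == 0 then (0%N, 0)
                           else (((v j).1 + q.1)%N, (v j).2 * q.2)).
  split=> // j; case: eqP => vj0.
  + by right.
  + case: (vK j) => [[v1K v2_gt0]|vj]; last by rewrite vj in vj0.
    by left; rewrite leq_add //= mulr_gt0.
  + case: (vK j) => [[_]|vj]; first by rewrite vj0 ltxx.
    have := est j; rewrite vj => /approx_nat0 T0.
    apply: approx0; apply: for_large_mono T0 _ => x _ /cards0_eq->.
    by rewrite big_set0.
  + apply/approxP => e e_gt0.
    have hq' d : 0 < d -> for_large (@psize _)
        (fun z : pointed (H ++ G) => C (projT1 z) /\ sat T (projT2 z))
        (fun z => `|(h z)%:R - q.2 * dimpow R N q.1 (psize z)|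
                  <= d * dimpow R N q.1 (psize z)) by exact: hq.
    have := approx_sum_solutions (fun n => dimpow_ge0 R N q.1 n) (ltW q2_gt0)
      (vK j) _ (est j) hq' e_gt0.
    case=> [x []//|B SB]; exists B => x Wx Bx /=.
    by have := SB x Wx Bx; rewrite (dimpowE _ _ q.1) -exprD.
- rewrite q0 in hq; have [B h0] := approx_nat0 hq.
  apply: definable_asymptotics_eq0; exists B => x Cx Bx.
  by apply: big1 => u; rewrite inE => uT; rewrite h0.
Qed.

Lemma definable_asymptotics_div K K' G H (T : formula (H ++ G))
    (h : pointed (H ++ G) -> nat) (q : nat * R) :
  definable_asymptotics K (fun x : pointed G => #|solutions T x|%:R) ->
  admissible K' q ->
  approx N (@psize _) (fun z : pointed (H ++ G) => C (projT1 z) /\ sat T (projT2 z))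
    (fun z => (h z)%:R) q ->
  definable_asymptotics K
    (fun x : pointed G => \sum_(u in solutions T x) (h (extend x u))%:R^-1).
Proof.
move=> [J [theta [v [vK cover est]]]] qK' hq.
case: (qK') => [[q1K' q2_gt0]|q0]; last first.
  (* Here [h] vanishes in large structures, and the convention 0^-1 = 0 makes every summand zero. *)
  rewrite q0 in hq; have [B h0] := approx_nat0 hq.
  apply: definable_asymptotics_eq0; exists B => x Cx Bx.
  by apply: big1 => u; rewrite inE => uT; rewrite h0 // invr0.
pose m n : R := (dimpow R N 1 n ^+ q.1)^-1.
have m_ge0 n : 0 <= m n by rewrite invr_ge0 exprn_ge0 // dimpow_ge0.
have qV_ge0 : 0 <= q.2^-1 by rewrite invr_ge0 ltW.
have hm d : 0 < d -> for_large (@psize _)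
    (fun z : pointed (H ++ G) => C (projT1 z) /\ sat T (projT2 z))
    (fun z => `|(h z)%:R^-1 - q.2^-1 * m (psize z)| <= d * m (psize z)).
  (* The first bound keeps [h] away from 0; the second compensates the factor 2 / q.2^2 of
     [inv_approx]. *)
  move=> d_gt0; pose d' := Num.min (q.2 / 2) (d * (q.2 ^+ 2 / 2)).
  have q22 : 0 < q.2 ^+ 2 / 2 by rewrite divr_gt0 ?exprn_gt0.
  have d'_gt0 : 0 < d' by rewrite lt_min (mulr_gt0 d_gt0 q22) andbT; apply: divr_gt0.
  have := for_large_and (for_large_root (R := R) (@psize _) N_gt0 _ 1)
    ((approxP _ _ _ _ _).1 hq _ d'_gt0).
  move/for_large_mono; apply => z _ [y_ge1 hz].
  have y_gt0 : 0 < root z by apply: lt_le_trans y_ge1.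
  have := inv_approx (exprn_gt0 q.1 y_gt0) q2_gt0 d'_gt0 _ hz.
  rewrite ge_min lexx => /(_ isT)/le_trans; apply.
  apply: ler_wpM2r; first exact: m_ge0.
  rewrite -ler_pdivlMr ?divr_gt0 ?exprn_gt0 //.
  by rewrite invf_div ge_min lexx orbT.
(* When (v j).1 < q.1 the sum tends to 0, so its value is (0, 0); truncated subtraction would
   wrongly give exponent 0 with a positive coefficient. *)
exists J, theta, (fun j => if ((v j).2 == 0) || ((v j).1 < q.1)%N then (0%N, 0)
                         else (((v j).1 - q.1)%N, (v j).2 / q.2)).
split=> // j; have SB := approx_sum_solutions m_ge0 qV_ge0 (vK j) _ (est j) hm.
  case: (vK j) => [[v1K v2_gt0]|->]; last by rewrite eqxx; right.
  rewrite gt_eqF //=; case: ltnP => _; first by right.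
  by left; split; [apply: leq_trans (leq_subr _ _) v1K|apply: divr_gt0].
have {}SB e : 0 < e -> for_large (@psize G)
    (fun x : pointed G => C (projT1 x) /\ sat (theta j) (projT2 x)) (fun x =>
      0 < root x /\ `|\sum_(u in solutions T x) (h (extend x u))%:R^-1
      - (v j).2 / q.2 * (root x ^+ (v j).1 / root x ^+ q.1)|
    <= e * (root x ^+ (v j).1 / root x ^+ q.1)).
  move=> e_gt0; have := for_large_and (for_large_root (R := R) (@psize _) N_gt0 _ 1)
    (SB (fun x => @proj1 _ _) e e_gt0).
  by move/for_large_mono; apply=> x _ [/(lt_le_trans ltr01)].
case: (vK j) => [[v1K v2_gt0]|vj]; last first.
  rewrite vj eqxx /=.
  have := est j; rewrite vj => /approx_nat0 T0.
  apply: approx0; apply: for_large_mono T0 _ => x _ /cards0_eq->.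
  by rewrite big_set0.
rewrite gt_eqF //=; case: ltnP => vq; apply/approxP => e e_gt0 /=; last first.
  apply: for_large_mono (SB e e_gt0) _ => x _ [y_gt0].
  by rewrite -expfB_cond // gt_eqF.
(* With y the root and a = (v j).2 / q.2, the sum is at most (a + 1) y^((v j).1 - q.1), hence at
   most (a + 1) / y, which is at most e once y >= (a + 1) / e. *)
apply: for_large_mono (for_large_and
  (for_large_root (@psize _) N_gt0 _ (Num.max 1 (((v j).2 / q.2 + 1) / e)))
  (SB 1 ltr01)) _ => x _ [+ [y_gt0]].
rewrite ge_max => /andP[y_ge1]; rewrite ler_pdivrMr // => y_ge.
set S := \sum_(u in _) _; set a := (v j).2 / q.2; set k := _ / _ => Sk.
have S_le : S <= (a + 1) * k by move: Sk; rewrite ler_norml; lra.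
have S_ge0 : 0 <= S by apply: sumr_ge0 => u _; rewrite invr_ge0 ler0n.
rewrite mul0r subr0 mulr1 ger0_norm //; apply: le_trans S_le _.
have k_le : k <= (root x)^-1.
  rewrite ler_pdivrMr ?exprn_gt0 // mulrC ler_pdivlMr // -exprSr.
  by rewrite ler_weXn2l.
have a_ge0 : 0 <= a + 1 by rewrite addr_ge0 // divr_ge0 // ltW.
apply: le_trans (ler_wpM2l a_ge0 k_le) _.
by rewrite ler_pdivrMr // mulrC.
Qed.

End DefinableAsymptotics.

Arguments extend [L G H] x u.

(** * Counting tuples in an asymptotic class *)

Section Counting.
Variables (R : realType) (N : nat) (L : language) (C : structure L -> Prop).
Hypothesis hC : asymptotic_class R N C.
Implicit Types (G H : seq (lsort L)).

Let N_gt0 : (0 < N)%N := hC.1.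

Lemma definable_asymptotics_fiber G s (phi : formula (s :: G)) :
  definable_asymptotics (R := R) N C N (fun x : pointed G => (fiber_size phi x)%:R).
Proof.
have [D [theta [DN cover est]]] := hC.2 s G phi.
exists (seq_sub D), (fun j => theta (ssval j)), (fun j => ssval j).
split=> [j|x Cx|j]; first exact: DN (ssvalP j).
  have [p [[pD xp] up]] := cover x Cx; exists (SeqSub pD).
  by split=> // j xj; apply: val_inj; apply: up; split=> //; apply: ssvalP.
exact: est (ssvalP j).
Qed.

Lemma card_solutions_cons G H s (phi : formula (s :: H ++ G)) (x : pointed G) :
  #|solutions (H := s :: H) phi x| =
  (\sum_(u : tup (projT1 x) H) fiber_size phi (extend x u))%N.
Proof.
rewrite -sum1_card big_mkcond /fiber_size /=.
under [RHS]eq_bigr do rewrite -sum1_card big_mkcond.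
rewrite exchange_big pair_big; apply: eq_bigr => -[b u] _.
by rewrite !inE.
Qed.

(** The first coordinate is counted by fibre sizes, with the rest of the tuple as parameters. The
    fibre cells are given by formulas, so the induction hypothesis counts the tuples in each of
    them; every coordinate adds at most N to the exponent. *)
Lemma definable_asymptotics_card G H (phi : formula (H ++ G)) :
  definable_asymptotics (R := R) N C (N * size H)
    (fun x : pointed G => #|solutions phi x|%:R).
Proof.
elim: H phi => [|s H IH] phi.
  (* There is one empty tuple: the count is 1 or 0 according to the truth of [phi], which defines
     the two cells. *)
  have /choice[t tE] (b : bool) :
      definable (fun (M : structure L) (a : tup M G) => b == sat phi a).
    case: b; first by exists phi => M a; case: sat.
    by exists (FNot phi) => M a; rewrite sat_FNot; case: sat.
  exists bool, t, (fun b : bool => (0%N, b%:R)); split=> [[]|x Cx|b].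
  - by left; split=> //; apply: ltr01.
  - by right.
  - exists (sat phi (projT2 x)); split=> [|b]; rewrite tE ?eqxx //.
    by move/eqP.
  - apply/approxP => e e_gt0; exists 0%N => x []; rewrite tE => _ /eqP bE _.
    suff -> : #|solutions (H := [::]) phi x| = b by rewrite /= mulr1 subrr normr0 mulr1 ltW.
    have [bT|bF] := boolP b.
      apply: (@eq_card1 _ (tt : tup (projT1 x) [::])) => -[].
      by rewrite !inE /= -bE bT.
    apply: eq_card0 => -[].
    by rewrite !inE /= -bE (negbTE bF).
have [J [theta [v [vN cover est]]]] :=
  @definable_asymptotics_fiber (H ++ G) s phi.
have := definable_asymptotics_partition N_gt0 cover (K := (N * size H + N)%N)
  (h := fun z => (fiber_size phi z)%:R)
  (fun j => definable_asymptotics_mul (IH (theta j)) (vN j) (est j)).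
rewrite [size _]/= mulnS addnC => phiK.
apply: definable_asymptotics_eq phiK => x _.
by rewrite (@card_solutions_cons G H s phi x) natr_sum.
Qed.

(* Tuples [u] with [#|solutions psi (extend x u)| = 0] contribute [0^-1 = 0]. *)
Lemma definable_asymptotics_sum_inv G H H' (phi : formula (H ++ G))
    (psi : formula (H' ++ (H ++ G))) :
  definable_asymptotics (R := R) N C (N * size H) (fun x : pointed G =>
    \sum_(u in solutions phi x) #|solutions psi (extend x u)|%:R^-1).
Proof.
have [J [theta [v [vN cover est]]]] := definable_asymptotics_card psi.
have /choice[t tE] (j : J) : definable (fun (M : structure L) (z : tup M (H ++ G)) =>
    sat (theta j) z && sat phi z).
  by apply: definable_and; apply: definable_sat.
(* Setting [h] to 0 outside [phi] lets the sum run over all tuples, as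
   [definable_asymptotics_partition] requires. *)
pose h (z : pointed (H ++ G)) : R :=
  if sat phi (projT2 z) then #|solutions psi z|%:R^-1 else 0.
have := @definable_asymptotics_partition R N L C N_gt0 (N * size H) G H J theta h cover.
move=> hK; apply: definable_asymptotics_eq (hK _) => [x _|j].
  by rewrite [RHS]big_mkcond; apply: eq_bigr => u _; rewrite inE.
have hj : approx N (@psize L _)
    (fun z : pointed (H ++ G) => C (projT1 z) /\ sat (t j) (projT2 z))
    (fun z => #|solutions psi z|%:R) (v j).
  by apply: approx_sub (est j) => z [Cz]; rewrite tE => /andP[].
have := definable_asymptotics_div N_gt0 (definable_asymptotics_card (t j)) (vN j) hj.
apply: definable_asymptotics_eq => x _.
rewrite [LHS]big_mkcond [RHS]big_mkcond; apply: eq_bigr => u _.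
by rewrite !inE tE /h; case: (sat (theta j) _).
Qed.

End Counting.

(** * Counting the classes of an equivalence relation *)

Section EquivalencePartition.
Variables (R : numFieldType) (T : finType) (e : rel T) (D : {set T}).
Hypothesis eqv : {in D & &, equivalence_rel e}.

Lemma equivalence_partitionE x : x \in D ->
  [set y in D | e x y] \in equivalence_partition e D.
Proof. by move=> xD; apply/imsetP; exists x. Qed.

Lemma equivalence_partition_block B x :
  B \in equivalence_partition e D -> x \in B -> x \in D /\ B = [set y in D | e x y].
Proof.
case/imsetP => z zD ->; rewrite inE => /andP[xD zx]; split=> //.
apply/setP => y; rewrite !inE; case yD: (y \in D) => //=.
by have [_ /(_ zx)] := eqv zD xD yD.
Qed.

(** A class B that satisfies [P] receives |B| summands, each equal to 1 / |B|. *)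
Lemma card_equivalence_partition (P : pred {set T}) :
  #|[set B in equivalence_partition e D | P B]|%:R =
  \sum_(x in D | P [set y in D | e x y]) #|[set y in D | e x y]|%:R^-1 :> R.
Proof.
have partD := equivalence_partitionP eqv.
rewrite (@set_partition_big_cond _ _ _ _ _ _ _ _ partD) /=.
rewrite -sum1_card natr_sum (eq_bigl (fun B => (B \in equivalence_partition e D) && P B));
  last by move=> B; rewrite inE.
rewrite big_mkcondr; apply: eq_bigr => B Bpart; case: ifP => PB.
  rewrite (eq_bigr (fun=> #|B|%:R^-1)) => [|x /andP[xB _]]; last first.
    by have [_ <-] := equivalence_partition_block Bpart xB.
  rewrite (eq_bigl [in B]) => [|x]; last first.
    apply: andb_idr => xB.
    by have [_ <-] := equivalence_partition_block Bpart xB.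
  (* Blocks of a partition are nonempty, so |B| / |B| = 1. *)
  rewrite sumr_const -[RHS]mulr_natl divff // pnatr_eq0 cards_eq0.
  by apply: contraTneq Bpart => ->; have /and3P[] := partD.
rewrite big_pred0 // => x; apply/negP => /andP[xB].
by have [_ <-] := equivalence_partition_block Bpart xB; rewrite PB.
Qed.

End EquivalencePartition.

(** * Translation of L'-formulas into L-formulas *)

Lemma tall2_lookup (S : Type) (A B : S -> finType) (P : forall s, A s -> B s -> bool)
    G s (x : var G s) (a : tup A G) (b : tup B G) :
  tall2 P a b -> P s (lookup x a) (lookup x b).
Proof. by elim: x a b => [{}s H|{}s t H x IH] [a1 a] [b1 b] /= /andP[// _ /IH]. Qed.

Lemma tall2_lookups (S : Type) (A B : S -> finType) (P : forall s, A s -> B s -> bool)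
    G H (x : vars G H) (a : tup A G) (b : tup B G) :
  tall2 P a b -> tall2 P (lookups x a) (lookups x b).
Proof.
move=> ab; elim: H x => [|s H IH] //= [x1 x]; rewrite IH andbT.
exact: tall2_lookup.
Qed.

Section Interpretation.
Variables (L L' : language) (r : nat) (I : scheme L L' r).

(** A tuple in this context codes an L'-tuple: a representative of each coordinate, then a single
    copy of the parameters. The parameters come last, so that a new L'-variable is a prefix. *)
Fixpoint ictx (G : seq (lsort L')) : seq (lsort L) :=
  if G is s :: G' then uctx I s ++ ictx G' else zctx I.

Fixpoint reps (A : lsort L -> finType) (G : seq (lsort L')) :
    tup A (ictx G) -> tup (fun t => tup A (uctx I t)) G :=
  match G return tup A (ictx G) -> tup (fun t => tup A (uctx I t)) G with
  | [::] => fun _ => tt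
  | s :: G' => fun w => (tleft w, reps (tright w))
  end.

Fixpoint params (A : lsort L -> finType) (G : seq (lsort L')) :
    tup A (ictx G) -> tup A (zctx I) :=
  match G return tup A (ictx G) -> tup A (zctx I) with
  | [::] => fun w => w
  | s :: G' => fun w => params (tright w)
  end.

Lemma reps_params_surj (A : lsort L -> finType) G
    (u : tup (fun t => tup A (uctx I t)) G) (c : tup A (zctx I)) :
  exists w : tup A (ictx G), reps w = u /\ params w = c.
Proof.
elim: G u => [[]|s G IH [u1 u]] /=; first by exists c.
have [w [wu wc]] := IH u.
by exists (tcat u1 w); rewrite tleft_tcat tright_tcat wu wc.
Qed.

Lemma selector_params G : selector (fun A (w : tup A (ictx G)) => params w).
Proof.
elim: G => [|s G IH]; first exact: selector_id.
exact: selector_comp (selector_tright _ _) IH.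
Qed.

Lemma selector_rep G t (x : var G t) :
  selector (fun A (w : tup A (ictx G)) => lookup x (reps w)).
Proof.
elim: x => [{}t K|{}t s K x IH]; first exact: selector_tleft.
exact: selector_comp (selector_tright _ _) IH.
Qed.

Lemma selector_tflat_reps G H (x : vars G H) :
  selector (fun A (w : tup A (ictx G)) => tflat (lookups x (reps w))).
Proof.
elim: H x => [|t H IH] /= x; first by exists tt.
exact: selector_tcat (selector_rep x.1) (IH x.2).
Qed.

Section Classes.
Variables (M : structure L) (c : tup M (zctx I)).
Hypothesis c_wd : well_defined c.

Lemma in_classE t (u : tup M (uctx I t)) (B : class_of c t) : in_class u B ->
  u \in udom c t /\ sval B = [set v in udom c t | ueqv c u v].
Proof. by move=> uB; apply: (equivalence_partition_block (c_wd.1 t) (svalP B)). Qed.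

Lemma in_class_eq t (u v : tup M (uctx I t)) (B B' : class_of c t) :
  in_class u B -> in_class v B' -> ueqv c u v = (B == B').
Proof.
move=> uB vB'; have [uD BE] := in_classE uB; have [vD B'E] := in_classE vB'.
have -> : ueqv c u v = (v \in sval B) by rewrite BE inE vD.
apply/idP/eqP => [vB|->//]; apply: val_inj => /=.
by rewrite B'E; have [] := in_classE (B := B) vB.
Qed.

Lemma class_of_inhabited t (B : class_of c t) :
  exists u : tup M (uctx I t), in_class u B.
Proof.
apply/set0Pn; apply: contraTneq (svalP B) => ->.
by have /and3P[] := equivalence_partitionP (c_wd.1 t).
Qed.

Lemma in_class_total t (u : tup M (uctx I t)) : u \in udom c t ->
  exists B : class_of c t, in_class u B.
Proof.
move=> uD; pose P := equivalence_partition (ueqv c (t := t)) (udom c t).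
exists (exist (fun B => B \in P) _ (equivalence_partitionE (ueqv c (t := t)) uD)).
by rewrite /in_class inE uD; have [] := c_wd.1 t u u u uD uD uD.
Qed.

Lemma tup_class_inhabited G (b : tup (class_of c) G) :
  exists u : tup (fun t => tup M (uctx I t)) G, tall2 (in_class (c := c)) u b.
Proof.
elim: G b => [|s G IH] b; first by exists tt.
have [u1 u1b] := class_of_inhabited b.1; have [u ub] := IH b.2.
by exists (u1, u); rewrite /= u1b ub.
Qed.

(** The relation on the quotient is witnessed by some representatives [v]. Both [u] and [v] lie in
    the classes [b], so they are equivalent coordinate by coordinate, and [well_defined] equates
    their values. *)
Lemma quotient_interp (P : lrel L') (u : tup (fun t => tup M (uctx I t)) (larity P))
    (b : tup (class_of c) (larity P)) :
  tall2 (in_class (c := c)) u b -> @interp L' (quotient c) P b = urel c u.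
Proof.
move=> ub; have inD G (v : tup (fun t => tup M (uctx I t)) G) (d : tup (class_of c) G) :
    tall2 (in_class (c := c)) v d -> tall (fun t x => x \in udom c t) v.
  elim: G v d => [|s G IH] //= [v1 v] [d1 d] /= /andP[/in_classE[-> _]].
  exact: IH.
apply/existsP/idP => [[v /andP[vb]]|uc]; last by exists u; rewrite ub.
suff vu : tall2 (ueqv c) v u by rewrite (c_wd.2 _ _ _ (inD _ _ _ vb) (inD _ _ _ ub) vu).
elim: (larity P) v u b ub vb => [|s G IH] //= [v1 v] [u1 u] [b1 b] /=.
move=> /andP[ub1 ub] /andP[vb1 vb].
by rewrite (in_class_eq vb1 ub1) eqxx; apply: IH ub vb.
Qed.

End Classes.

(** Equality becomes [epsilon], a relation its [relform], and a quantifier over a sort becomes one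
    over tuples relativised to [delta]. The code [w] of [b] is arbitrary, so in the quantifier case
    any representative of the new element will do. *)
Lemma translation G (phi : @formula L' G) : exists f : @formula L (ictx G),
  forall (M : structure L) (c : tup M (zctx I)) (w : tup M (ictx G))
    (b : tup (quotient c) G),
  well_defined c -> params w = c ->
  tall2 (in_class (c := c)) (reps w) b -> sat f w = sat phi b.
Proof.
elim: phi => {G} [G|G t x y|G P x|G p [f fE] q [g gE]|G t p [f fE]].
- by exists (FFalse _).
- have [f fE] : definable (fun (M : structure L) (w : tup M (ictx G)) =>
      sat (epsilon I t)
        (tcat (lookup x (reps w)) (tcat (lookup y (reps w)) (params w)))).
    exact: (definable_select (definable_sat (epsilon I t)) (selector_tcat
      (selector_rep x) (selector_tcat (selector_rep y) (selector_params G)))).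
  exists f => M c w b c_wd wc wb; rewrite fE wc.
  exact: in_class_eq (tall2_lookup x wb) (tall2_lookup y wb).
- have [f fE] : definable (fun (M : structure L) (w : tup M (ictx G)) =>
      sat (relform I P) (tcat (tflat (lookups x (reps w))) (params w))).
    exact: (definable_select (definable_sat (relform I P))
      (selector_tcat (selector_tflat_reps x) (selector_params G))).
  exists f => M c w b c_wd wc wb; rewrite fE wc.
  by rewrite [RHS](quotient_interp c_wd (tall2_lookups x wb)).
- exists (FImp f g) => M c w b c_wd wc wb.
  by rewrite /= (fE M c w b) // (gE M c w b).
- have [g gE] : definable (fun (M : structure L) (w : tup M (ictx G)) =>
      [forall u : tup M (uctx I t),
        sat (delta I t) (tcat u (params w)) ==> sat f (tcat u w)]).
    have dP : definable (fun (M : structure L) (w : tup M (ictx (t :: G))) =>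
        sat (delta I t) (tcat (tleft w) (params (tright w))) ==> sat f w).
      apply: definable_imp (definable_sat f).
      exact: (definable_select (definable_sat (delta I t))
        (selector_tcat (selector_tleft (uctx I t) (ictx G))
          (selector_comp (selector_tright (uctx I t) (ictx G)) (selector_params G)))).
    apply: definable_eq (definable_all dP) => M w.
    by apply: eq_forallb => u; rewrite tleft_tcat tright_tcat.
  exists g => M c w b c_wd wc wb; rewrite gE /= wc.
  have step u (B : class_of c t) : in_class u B ->
      sat f (tcat u w : tup M (ictx (t :: G))) = sat p ((B, b) : tup (quotient c) (t :: G)).
    move=> uB; apply: (fE M c) => //=; first by rewrite tright_tcat.
    by rewrite tleft_tcat tright_tcat uB.
  apply/forallP/forallP => [fa B|fa u].
    have [u uB] := class_of_inhabited c_wd B; rewrite -(step u B uB).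
    apply: (implyP (fa u)).
    by have [] := in_classE c_wd uB; rewrite inE.
  apply/implyP => uD; have [|B uB] := @in_class_total _ _ c_wd t u; first by rewrite inE.
  by rewrite (step u B uB).
Qed.

End Interpretation.

(** * From powers of |M| to powers of |A| *)

Section Rescaling.
Variable R : realType.

(** For s between 0 and 1, u^s lies between 1 and u. *)
Lemma powR_sub1_le (u s : R) : 0 < u -> 0 <= s <= 1 -> `|u `^ s - 1| <= `|u - 1|.
Proof.
move=> u_gt0 /andP[s_ge0 s_le1].
have [u_le1|/ltW u_ge1] := leP u 1.
  have u01 : 0 < u <= 1 by rewrite u_gt0.
  have := ger1_powR u01 s_le1; have := ger_powR u01 s_ge0; rewrite powRr0 => us1 us.
  by rewrite !ler0_norm ?subr_le0 //; lra.
have := ler1_powR u_ge1 s_le1; have := ler_powR u_ge1 s_ge0; rewrite powRr0 => us1 us.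
by rewrite !ger0_norm ?subr_ge0 //; lra.
Qed.

(** Put s = d / e <= 1 and u = a / (lam y^e). Then a^s = u^s lam^s y^d, and u^s is at least as close
    to 1 as u is. The bound e1 <= lam / 2 gives u^s >= 1/2; the next hypothesis absorbs the error of
    [k] together with that of u^s. *)
Lemma rescale_estimate (k a y lam mu e1 e2 : R) (d e : nat) :
  0 < y -> 0 < lam -> 0 < mu -> (0 < e)%N -> (d <= e)%N ->
  0 < e1 -> e1 <= lam / 2 -> e1 * (1 + mu / lam) <= e2 * (lam `^ (d%:R / e%:R) / 2) ->
  `|k - mu * y ^+ d| <= e1 * y ^+ d -> `|a - lam * y ^+ e| <= e1 * y ^+ e ->
  `|k - mu * lam `^ (- (d%:R / e%:R)) * a `^ (d%:R / e%:R)|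
    <= e2 * a `^ (d%:R / e%:R).
Proof.
move=> y_gt0 lam_gt0 mu_gt0 e_gt0 de e1_gt0 e1_le e1e2 kd ae.
set s := d%:R / e%:R in e1e2 *.
have eR_gt0 : 0 < e%:R :> R by rewrite ltr0n.
have s01 : 0 <= s <= 1.
  by rewrite divr_ge0 ?ler0n //= ler_pdivrMr // mul1r ler_nat.
have yd_gt0 := exprn_gt0 d y_gt0; have ye_gt0 := exprn_gt0 e y_gt0.
have ly_gt0 : 0 < lam * y ^+ e by rewrite mulr_gt0.
pose u := a / (lam * y ^+ e).
have aE : a = u * (lam * y ^+ e) by rewrite divfK // gt_eqF.
have u1 : `|u - 1| <= e1 / lam.
  rewrite -(ler_pM2r ly_gt0) -{1}(gtr0_norm ly_gt0) -normrM mulrBl -aE mul1r.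
  by rewrite mulrA divfK ?gt_eqF.
have e1lam : e1 / lam <= 2^-1 by rewrite ler_pdivrMr // mulrC.
have u_gt0 : 0 < u by move: u1; rewrite ler_norml => /andP[+ _]; lra.
have us1 := le_trans (powR_sub1_le u_gt0 s01) u1.
have us_ge : 2^-1 <= u `^ s by move: us1; rewrite ler_norml => /andP[+ _]; lra.
have yesE : (y ^+ e) `^ s = y ^+ d.
  rewrite -(powR_mulrn _ (ltW y_gt0)) -powRrM mulrC divfK ?gt_eqF //.
  exact: powR_mulrn (ltW y_gt0).
have asE : a `^ s = u `^ s * lam `^ s * y ^+ d.
  by rewrite aE powRM ?ltW // powRM ?ltW // yesE mulrA.
have ls_gt0 : 0 < lam `^ s by apply: powR_gt0.
rewrite asE powRN; set us := u `^ s in us1 us_ge *; set ls := lam `^ s in ls_gt0 e1e2 *.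
have -> : k - mu * ls^-1 * (us * ls * y ^+ d) =
    (k - mu * y ^+ d) - (us - 1) * (mu * y ^+ d).
  by field; rewrite gt_eqF.
apply: le_trans (ler_normB _ _) _.
have my_gt0 : 0 < mu * y ^+ d by rewrite mulr_gt0.
rewrite [`|_ * (mu * _)|]normrM (gtr0_norm my_gt0).
have := ler_wpM2r (ltW my_gt0) us1.
have := ler_wpM2r (ltW yd_gt0) e1e2.
have e2_gt0 : 0 < e2.
  have : 0 < e2 * (ls / 2).
    by apply: lt_le_trans e1e2; rewrite mulr_gt0 // addr_gt0 // divr_gt0.
  by rewrite pmulr_lgt0 // divr_gt0.
have := ler_wpM2r (ltW (mulr_gt0 (mulr_gt0 e2_gt0 ls_gt0) yd_gt0)) us_ge.
by lra.
Qed.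

(* A set of size about [q.2 * M ^ (q.1 / N)] in a structure of size about
   [a = p.2 * M ^ (p.1 / N)] has size about
   [q.2 * p.2 ^ (- q.1 / p.1) * a ^ (q.1 / p.1)]. *)
Definition rescale (K : nat) (p q : nat * R) : nat * R :=
  if [&& (0 < p.1)%N, (q.1 <= p.1)%N, (p.1 %| K)%N, 0 < p.2 & 0 < q.2]
  then ((q.1 * (K %/ p.1))%N, q.2 * p.2 `^ (- (q.1%:R / p.1%:R)))
  else (0%N, 0).

Lemma admissible_rescale K p q : admissible K (rescale K p q).
Proof.
rewrite /rescale; case: ifP => [/and5P[p_gt0 qp pK p2 q2]|_]; last by right.
left; rewrite mulr_gt0 ?powR_gt0 //=; split=> //.
by rewrite -{2}(divnK pK) mulnC leq_mul2l qp orbT.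
Qed.

(** As p.1 divides K, the exponent q.1 (K / p.1) / K is exactly q.1 / p.1. *)
Lemma approx_rescale (N : nat) (T : Type) (sz k a : T -> nat) (W : T -> Prop)
    (p q : nat * R) (Kq K : nat) :
  (0 < N)%N -> (0 < K)%N -> (0 < p.1)%N -> 0 < p.2 -> (p.1 %| K)%N ->
  admissible Kq q -> (forall x, W x -> (k x <= a x)%N) ->
  approx N sz W (fun x => (k x)%:R) q -> approx N sz W (fun x => (a x)%:R) p ->
  forall eps, 0 < eps -> for_large sz W (fun x =>
    `|(k x)%:R - (rescale K p q).2 * dimpow R K (rescale K p q).1 (a x)|
    <= eps * dimpow R K (rescale K p q).1 (a x)).
Proof.
move=> N_gt0 K_gt0 p1_gt0 p2_gt0 pK qa ka kq ap eps eps_gt0.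
rewrite /rescale p1_gt0 p2_gt0 pK /=.
case: qa => [[_ q2_gt0]|q0]; last first.
  rewrite q0 in kq *; rewrite ltxx andbF.
  have [B k0] := approx_nat0 kq; exists B => x Wx Bx.
  by rewrite k0 //= mul0r subrr normr0; apply: mulr_ge0 (ltW eps_gt0) (dimpow_ge0 _ _ _ _).
rewrite q2_gt0 andbT; move/approxP: kq => kq; move/approxP: ap => ap.
case: leqP => qp /=.
  set s : R := q.1%:R / p.1%:R.
  have sE : (q.1 * (K %/ p.1))%:R / K%:R = s.
    have -> : K%:R = (K %/ p.1)%:R * p.1%:R :> R by rewrite -natrM divnK.
    have Kp : (K %/ p.1)%:R != 0 :> R by rewrite pnatr_eq0 -lt0n divn_gt0 // dvdn_leq.
    by rewrite natrM /s; field; rewrite Kp pnatr_eq0 -lt0n p1_gt0.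
  have c_gt0 : 0 < eps * (p.2 `^ s / 2) by rewrite mulr_gt0 // divr_gt0 ?powR_gt0.
  have t_gt0 : 0 < 1 + q.2 / p.2 by rewrite addr_gt0 // divr_gt0.
  pose e1 := Num.min (p.2 / 2) (eps * (p.2 `^ s / 2) / (1 + q.2 / p.2)).
  have e1_gt0 : 0 < e1 by rewrite lt_min (divr_gt0 c_gt0 t_gt0) andbT divr_gt0.
  apply: for_large_mono (for_large_and (for_large_root (R := R) sz N_gt0 W 1)
    (for_large_and (kq _ e1_gt0) (ap _ e1_gt0))) _ => x _ [y_ge1 [kx ax]].
  rewrite /dimpow sE; apply: rescale_estimate kx ax => //.
  - exact: lt_le_trans y_ge1.
  - by rewrite ge_min lexx.
  - by rewrite -ler_pdivlMr // ge_min lexx orbT.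
(* If q.1 > p.1, then k >= (q.2 / 2) y^(q.1) would exceed a <= (p.2 + 1) y^(p.1) for large y,
   against k <= a: no large [x] remains in [W]. *)
have q22 : 0 < q.2 / 2 by rewrite divr_gt0.
apply: for_large_mono (for_large_and
  (for_large_root (R := R) sz N_gt0 W (Num.max 1 ((p.2 + 2) / (q.2 / 2))))
  (for_large_and (kq _ q22) (ap _ ltr01))) _ => x Wx [+ [kx ax]].
rewrite ge_max => /andP[y_ge1]; rewrite ler_pdivrMr // => y_ge.
set y := dimpow R N 1 (sz x) in y_ge1 y_ge kx ax.
have ye_gt0 : 0 < y ^+ p.1 by rewrite exprn_gt0 // (lt_le_trans ltr01).
have yd : y * y ^+ p.1 <= y ^+ q.1 by rewrite -exprS ler_weXn2l.
have kxa : (k x)%:R <= (a x)%:R :> R by rewrite ler_nat ka.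
suff: false by [].
move: kx ax; rewrite !ler_norml => /andP[kx _] /andP[_ ax].
have := ler_wpM2l (ltW q22) yd; have := ler_wpM2r (ltW ye_gt0) y_ge.
by lra.
Qed.

End Rescaling.

(** Cells of a weak class need not be definable, so a finite cover suffices: each [x] gets the value
    of one index whose cell contains it, which makes the value unique and merges indices of equal
    value. *)
Lemma asymptotic_cells_cover (R : realType) (N : nat) (L : language)
    (C : structure L -> Prop) (s : lsort L) (G : seq (lsort L))
    (phi : formula (s :: G)) (J : finType) (v : J -> nat * R)
    (cell : J -> pointed G -> Prop) :
  (forall j, admissible N (v j)) ->
  (forall x, C (projT1 x) -> exists j, cell j x) ->
  (forall j, approx N (@psize L G) (fun x => C (projT1 x) /\ cell j x)
     (fun x => (fiber_size phi x)%:R) (v j)) ->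
  exists (D : seq (nat * R)) (cell' : nat * R -> pointed G -> Prop),
    asymptotic_cells N C phi D cell'.
Proof.
move=> vN cover est; pose vpick x := omap v [pick j | `[< cell j x >]].
exists [seq v j | j : J], (fun p x => vpick x = Some p); split=> [p|x Cx|p _ e e_gt0].
- by case/imageP => j _ ->.
- have [i xi] := cover x Cx; rewrite /vpick; case: pickP => [j _|/(_ i)] /=.
    by exists (v j); split=> [|p [_ [<-]]//]; split=> //; apply: image_f.
  by move=> /asboolP.
have estP j : for_large (@psize L G)
    (fun x => C (projT1 x) /\ vpick x = Some p)
    (fun x => cell j x -> v j = p -> `|(fiber_size phi x)%:R
      - p.2 * dimpow R N p.1 (psize x)| <= e * dimpow R N p.1 (psize x)).
  have [B estB] := est j e e_gt0; exists B => x [Cx _] Bx xj <-.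
  exact: estB.
have [B estB] := for_large_all estP.
exists B => x [Cx xp] Bx; have := estB x (conj Cx xp) Bx.
move: xp; rewrite /vpick; case: pickP => [j /asboolP xj [vj]|//].
by move/(_ j); apply.
Qed.

(** * Asymptotics in the interpreted class *)

Section UniformInterpretation.
Variables (R : realType) (L L' : language) (C : structure L -> Prop).
Variables (D : structure L' -> Prop) (N r : nat).
Hypothesis hC : asymptotic_class R N C.
Variable I : uniform_interpretation C D r.

(** [X] holds of the representatives of elements satisfying [phi], and [Z] cuts out the class of
    such a representative; summing the inverses of the class sizes counts the elements.
    Representatives have length r, whence the bound N r. *)
Lemma quotient_fiber s G (phi : @formula L' (s :: G)) :
  exists g : pointed (ictx I G) -> R, definable_asymptotics N C (N * r) g /\
  forall (M : structure L) (c : tup M (zctx I)) (w : tup M (ictx I G))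
    (b : tup (quotient c) G),
  well_defined c -> params w = c -> tall2 (in_class (c := c)) (reps w) b ->
  g (existT (fun M : structure L => tup M (ictx I G)) M w) =
    #|[set B : class_of c s | sat phi ((B, b) : tup (quotient c) (s :: G))]|%:R.
Proof.
have [f fE] := translation I phi.
have [X XE] : definable (fun (M : structure L) (w : tup M (ictx I (s :: G))) =>
    sat (delta I s) (tcat (tleft w) (params (tright w))) && sat f w).
  apply: definable_and (definable_sat f).
  exact: (definable_select (definable_sat (delta I s))
    (selector_tcat (selector_tleft (uctx I s) (ictx I G))
      (selector_comp (selector_tright (uctx I s) (ictx I G)) (selector_params I G)))).
have tl := selector_tleft (uctx I s) (uctx I s ++ ictx I G).
have tr := selector_tright (uctx I s) (uctx I s ++ ictx I G).
have trl := selector_comp tr (selector_tleft (uctx I s) (ictx I G)).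
have trc := selector_comp tr (selector_comp
  (selector_tright (uctx I s) (ictx I G)) (selector_params I G)).
have [Z ZE] := definable_and
  (definable_select (definable_sat (delta I s)) (selector_tcat tl trc))
  (definable_select (definable_sat (epsilon I s))
    (selector_tcat trl (selector_tcat tl trc))).
exists (fun x => \sum_(u in solutions X x) #|solutions Z (extend x u)|%:R^-1); split.
  by have := definable_asymptotics_sum_inv hC X Z; rewrite size_uctx.
move=> M c w b c_wd wc wb; set x := existT _ M w.
(* [card_equivalence_partition] needs a predicate on bare sets, whereas [phi] is evaluated at
   elements of [class_of]. *)
pose P (A : {set tup M (uctx I s)}) := [exists B : class_of c s,
  (sval B == A) && sat phi ((B, b) : tup (quotient c) (s :: G))].
rewrite -(card_imset _ val_inj).
have -> : [set val B | B in [set B : class_of c s |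
    sat phi ((B, b) : tup (quotient c) (s :: G))]] =
    [set A in equivalence_partition (ueqv c (t := s)) (udom c s) | P A].
  apply/setP => A; rewrite !inE; apply/imsetP/andP => [[B]|[_ /existsP[B /andP[/eqP<- pB]]]].
    rewrite inE => pB ->; split; first exact: (valP B).
    by apply/existsP; exists B; rewrite eqxx.
  by exists B => //; rewrite inE.
rewrite (card_equivalence_partition _ (c_wd.1 s)).
apply: eq_big => [u|u].
  rewrite !inE XE tleft_tcat tright_tcat wc; case uD: (sat (delta I s) _) => //=.
  have {}uD : u \in udom c s by rewrite inE.
  have [B uB] := in_class_total c_wd uD; have [_ BE] := in_classE c_wd uB.
  rewrite (fE M c _ ((B, b) : tup (quotient c) (s :: G)) c_wd) /=; last 2 first.
  - by rewrite tright_tcat.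
  - by rewrite tleft_tcat tright_tcat uB.
  apply/idP/existsP => [pB|[B' /andP[/eqP B'E]]].
    by exists B; rewrite BE eqxx.
  by rewrite (_ : B' = B) //; apply: val_inj; rewrite /= B'E.
move=> _; congr (_%:R^-1); apply: eq_card => v.
by rewrite !inE ZE !(tleft_tcat, tright_tcat) wc.
Qed.

Lemma fiber_size_interpretation s G (phi : @formula L' (s :: G)) :
  exists g : pointed (ictx I G) -> R, definable_asymptotics N C (N * r) g /\
  forall (A : member D) (b : tup (sval A) G) (w : tup (sval (ui_alpha I A)) (ictx I G)),
  params w = ui_param I A ->
  tall2 (in_class (c := ui_param I A)) (reps w) (tmap (@ui_iota _ _ _ _ _ I A) b) ->
  g (existT (fun M : structure L => tup M (ictx I G)) (sval (ui_alpha I A)) w) =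
    (fiber_size phi (existT (fun M : structure L' => tup M G) (sval A) b))%:R.
Proof.
have [g [gK gE]] := quotient_fiber phi; exists g; split=> // A b w wc wb.
rewrite (gE _ _ _ _ (ui_well_defined I A) wc wb) /fiber_size /=; congr _%:R.
have iso := ui_iota_iso I A; have [iota_bij _] := iso.
rewrite -(card_imset _ (bij_inj (iota_bij s))); apply: eq_card => B.
rewrite inE; apply/idP/imsetP => [pB|[x]].
  have [h hK Kh] := iota_bij s; exists (h B); last by rewrite Kh.
  by rewrite inE -(sat_isomorphism _ _ iso) /= Kh.
by rewrite inE -(sat_isomorphism _ _ iso) => px ->.
Qed.

Lemma ssize_interpretation (A : member D) :
  ssize (sval A) = (\sum_(t : lsort L') #|class_of (ui_param I A) t|)%N.
Proof.
apply: eq_bigr => t _; apply: bij_eq_card.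
exact: (ui_iota_iso I A).1.
Qed.

Lemma ssize_interpretation_asymptotics :
  exists g : pointed (zctx I) -> R, definable_asymptotics N C (N * r) g /\
  forall A : member D,
    g (existT (fun M : structure L => tup M (zctx I)) (sval (ui_alpha I A))
        (ui_param I A)) = (ssize (sval A))%:R.
Proof.
(* The negation of [FFalse] is always true, so its fibre is the whole sort [t]. *)
have /choice[g gP] (t : lsort L') := quotient_fiber (FNot (FFalse [:: t])).
exists (fun x => \sum_t g t x); split.
  by apply: (definable_asymptotics_sum hC.1) => t; have [] := gP t.
move=> A; rewrite ssize_interpretation natr_sum; apply: eq_bigr => t _.
have [_ /(_ _ _ _ (tt : tup (quotient (ui_param I A)) [::]) (ui_well_defined I A) erefl)] := gP t.
move=> -> //; congr _%:R; apply: eq_card => B.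
by rewrite inE sat_FNot.
Qed.

Lemma size_partition_exists :
  exists (F : seq (nat * R)) (chi : nat * R -> formula (zctx I)),
    size_partition N F chi.
Proof.
have [g [[J [theta [v [vK cover est]]]] gE]] := ssize_interpretation_asymptotics.
pose x (A : member D) := existT (fun M : structure L => tup M (zctx I))
  (sval (ui_alpha I A)) (ui_param I A).
have xC A : C (projT1 (x A)) := svalP (ui_alpha I A).
(* A [size_partition] is indexed by values, so the formulas of all cells with the same value are
   joined in a disjunction. *)
exists [seq v j | j : J],
  (fun p => \big[@FOr L (zctx I)/FFalse (zctx I)]_(j | v j == p) theta j).
split=> [p|A|p _ e e_gt0].
- by case/imageP => j _ ->.
- have [j [xj uj]] := cover (x A) (xC A); exists (v j); split.
    split; first exact: image_f.
    by rewrite /size_cell sat_bigFOr; apply/existsP; exists j; rewrite eqxx.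
  move=> p [_]; rewrite /size_cell sat_bigFOr => /existsP[i /andP[/eqP<-]].
  by move/uj->.
have estP j : for_large (@psize L _) (fun y : pointed (zctx I) => C (projT1 y))
    (fun y => sat (theta j) (projT2 y) -> v j = p -> `|g y
      - p.2 * dimpow R N p.1 (psize y)| <= e * dimpow R N p.1 (psize y)).
  have [B estB] := est j e e_gt0; exists B => y Cy By yj <-.
  exact: estB.
have [B estB] := for_large_all estP.
exists B => A; rewrite /size_cell sat_bigFOr => /existsP[j /andP[/eqP vj Aj]] BA.
by have := estB (x A) (xC A) BA j Aj vj; rewrite gE.
Qed.

Lemma card_tup_le (M : structure L) G : (#|tup M G| <= ssize M ^ size G)%N.
Proof.
elim: G => [|s G IH]; first by rewrite card_unit.
rewrite /= card_prod expnS leq_mul //.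
by rewrite /ssize (bigD1 s) //= leq_addr.
Qed.

Lemma ssize_interpretation_le (A : member D) :
  (ssize (sval A) <= #|lsort L'| * ssize (sval (ui_alpha I A)) ^ r)%N.
Proof.
rewrite ssize_interpretation -sum_nat_const; apply: leq_sum => t _.
rewrite card_sig; apply: leq_trans (leq_imset_card _ _) _.
apply: leq_trans (max_card _) _.
by have := card_tup_le (sval (ui_alpha I A)) (uctx I t); rewrite size_uctx.
Qed.

(** Estimates hold for large alpha(A), while [D] asks for large A. The passage is possible since |A|
    is at most a constant times |alpha(A)|^r. *)
Lemma ssize_interpretation_large (B : nat) : exists B' : nat, forall A : member D,
  (B' < ssize (sval A))%N -> (B < ssize (sval (ui_alpha I A)))%N.
Proof.
exists (#|lsort L'| * B ^ r)%N => A /leq_trans/(_ (ssize_interpretation_le A)).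
rewrite !ltnNge; apply: contra => AB.
by rewrite leq_mul2l leq_exp2r ?AB ?orbT // (ui_arity_gt0 I).
Qed.

(** With exponent 0, |A| would be at most p.2 + 1 as soon as alpha(A) is large; so unbounded sizes
    force a positive exponent. *)
Lemma size_cell_bounded_or_unbounded F (chi : nat * R -> formula (zctx I)) p :
  size_partition N F chi -> p \in F ->
  (exists B : nat, forall A, size_cell chi p A -> (ssize (sval A) <= B)%N) \/
  [/\ (0 < p.1)%N, 0 < p.2 & unbounded_exponent F chi p.1].
Proof.
move=> [FK cover est] pF.
have [|unb] := EM (exists B : nat, forall A, size_cell chi p A -> (ssize (sval A) <= B)%N).
  by left.
have {}unb B : exists A, size_cell chi p A /\ (B < ssize (sval A))%N.
  apply: contrapT => bd; apply: unb; exists B => A pA.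
  by rewrite leqNgt; apply/negP => BA; apply: bd; exists A.
right; suff p1_gt0 : (0 < p.1)%N.
  have p2_gt0 : 0 < p.2 by case: (FK p pF) p1_gt0 => [[]|->].
  by split=> //; split=> //; exists p.2; rewrite -surjective_pairing.
rewrite lt0n; apply/eqP => p10; have [B estB] := est p pF 1 ltr01.
have [B' large] := ssize_interpretation_large B.
have p2_ge0 := admissible_ge0 (FK p pF).
(* This [A] is large enough both for the estimate with error 1 to apply and for |A| to exceed p.2 +
   1. *)
have [A [pA]] := unb (maxn B' (Num.bound (p.2 + 1))).
rewrite gtn_max => /andP[/large AB Ap]; have := estB A pA AB.
rewrite p10 /dimpow mul0r powRr0 !mulr1 ler_norml => /andP[_].
have p21_ge0 : 0 <= p.2 + 1 by rewrite addr_ge0.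
have := archi_boundP p21_ge0; have : (Num.bound (p.2 + 1))%:R < (ssize (sval A))%:R :> R.
  by rewrite ltr_nat.
lra.
Qed.

Lemma fiber_size_le (M : structure L') s G (phi : formula (s :: G)) (b : tup M G) :
  (fiber_size phi (existT (fun M : structure L' => tup M G) M b) <= ssize M)%N.
Proof.
apply: leq_trans (max_card _) _.
by rewrite /ssize (bigD1 s) //= leq_addr.
Qed.

(** A cell combines a size cell of A with a cell of the count. A tuple of A has many codes in
    alpha(A) and may lie in several such cells, which a cover allows. *)
Lemma weak_asymptotic_class_interpretation F (chi : nat * R -> formula (zctx I)) K :
  size_partition N F chi -> (0 < K)%N ->
  (forall e, unbounded_exponent F chi e -> (e %| K)%N) ->
  weak_asymptotic_class R K D.
Proof.
move=> Fchi K_gt0 dvK; split=> // s G phi.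
have [g [[J [theta [v [vK cover est]]]] gE]] := fiber_size_interpretation phi.
(* An element of [T] is a tuple of A with a candidate code; [W] demands that it be a code over the
   parameters of A and places it in a pair of cells. *)
pose T := {A : member D & (tup (sval A) G * tup (sval (ui_alpha I A)) (ictx I G))%type}.
pose str (t : T) := existT (fun M : structure L' => tup M G)
  (sval (projT1 t)) (projT2 t).1.
pose host (t : T) := existT (fun M : structure L => tup M (ictx I G))
  (sval (ui_alpha I (projT1 t))) (projT2 t).2.
have hostC t : C (projT1 (host t)) := svalP (ui_alpha I (projT1 t)).
pose W (pj : seq_sub F * J) (t : T) : Prop :=
  [/\ size_cell chi (ssval pj.1) (projT1 t),
      params (projT2 t).2 = ui_param I (projT1 t),
      tall2 (in_class (c := ui_param I (projT1 t))) (reps (projT2 t).2)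
        (tmap (@ui_iota _ _ _ _ _ I (projT1 t)) (projT2 t).1)
    & sat (theta pj.2) (projT2 t).2].
apply: (asymptotic_cells_cover (J := (seq_sub F * J)%type)
  (v := fun pj => rescale K (ssval pj.1) (v pj.2))
  (cell := fun pj x => exists2 t, x = str t & W pj t)) => [pj|[M b] DM|[p j]].
- exact: admissible_rescale.
- pose A : member D := exist _ M DM.
  have [FK Fcover _] := Fchi; have [p [[pF Ap] _]] := Fcover A.
  have [u ub] := tup_class_inhabited (ui_well_defined I A)
    (tmap (@ui_iota _ _ _ _ _ I A) (b : tup (sval A) G)).
  have [w [wu wc]] := reps_params_surj u (ui_param I A).
  pose t : T := existT _ A (b, w).
  have [j [tj _]] := cover (host t) (hostC t).
  by exists (SeqSub pF, j), t => //; split=> //=; rewrite wu.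
have [FK Fcover Fest] := Fchi.
(* If sizes are bounded on the cell, the bound is a threshold beyond which nothing remains;
   otherwise the exponent is positive and divides K, and [approx_rescale] applies. *)
have [[B bd]|[p1_gt0 p2_gt0 /dvK pK]] := size_cell_bounded_or_unbounded Fchi (ssvalP p).
  move=> e e_gt0; exists B => x [_ [t -> [/bd tB _ _ _]]].
  by rewrite ltnNge tB.
pose sz (t : T) := psize (host t).
have kq : approx N sz (W (p, j)) (fun t => (fiber_size phi (str t))%:R) (v j).
  move=> e e_gt0; have [B estB] := est j e e_gt0; exists B => t [_ tc tb tj] Bt.
  by have := estB (host t) (conj (hostC t) tj) Bt; rewrite (gE _ (projT2 t).1).
have ap : approx N sz (W (p, j)) (fun t => (ssize (sval (projT1 t)))%:R) (ssval p).
  move=> e e_gt0; have [B estB] := Fest _ (ssvalP p) e e_gt0.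
  by exists B => t [tp _ _ _]; apply: estB.
move=> e e_gt0.
have [B estB] := approx_rescale hC.1 K_gt0 p1_gt0 p2_gt0 pK (vK j)
  (fun t _ => fiber_size_le phi (projT2 t).1) kq ap e_gt0.
have [B' large] := ssize_interpretation_large B.
exists B' => x [_ [t -> tW]] B't.
by apply: estB => //; apply: large.
Qed.

End UniformInterpretation.

(** * Least common multiples of the exponents, and conclusion *)

Lemma biglcmn_gt0 m n (P : pred nat) : (forall e, (m <= e < n)%N -> P e -> (0 < e)%N) ->
  (0 < \big[lcmn/1]_(m <= e < n | P e) e)%N.
Proof.
move=> e_gt0; rewrite big_nat_cond; elim/big_ind: _ => // [a b|e /andP[]].
  by rewrite lcmn_gt0 => -> ->.
exact: e_gt0.
Qed.

Lemma dvdn_biglcmn m n (P : pred nat) e : (m <= e < n)%N -> P e ->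
  (e %| \big[lcmn/1]_(m <= i < n | P i) i)%N.
Proof.
move=> emn Pe; by rewrite (big_rem e) ?mem_index_iota //= Pe dvdn_lcml.
Qed.

Theorem corollary8p9 (R : realType) (L L' : language)
    (C : structure L -> Prop) (D : structure L' -> Prop) (N r : nat)
    (hC : asymptotic_class R N C)
    (I : uniform_interpretation C D r) :
  (exists (F : seq (nat * R)) (chi : nat * R -> formula (zctx I)),
     size_partition N F chi) /\
  (forall (F : seq (nat * R)) (chi : nat * R -> formula (zctx I)),
     size_partition N F chi ->
     weak_asymptotic_class R (LQ N F chi) D) /\
  weak_asymptotic_class R (\big[lcmn/1]_(1 <= e < (N * r).+1) e)%N D.
Proof.
(* Admissibility bounds the exponents by N r, so each relevant one is a term of both least common
   multiples. *)
have exponent_le (F : seq (nat * R)) chi e : size_partition N F chi ->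
    unbounded_exponent (I := I) F chi e -> (0 < e < (N * r).+1)%N.
  move=> [FK _ _] [-> [lam [lam_gt0 /FK[[]//|[_ lam0] _]]]].
  by rewrite lam0 ltxx in lam_gt0.
have [F0 [chi0 Fchi0]] := size_partition_exists hC I.
split; [by exists F0, chi0|split=> [F chi Fchi|]].
  apply: (weak_asymptotic_class_interpretation hC Fchi).
    by apply: biglcmn_gt0 => e _ /asboolP[].
  move=> e eu; apply: dvdn_biglcmn; last exact/asboolP.
  by have /andP[_] := exponent_le _ _ _ Fchi eu.
apply: (weak_asymptotic_class_interpretation hC Fchi0).
  by apply: biglcmn_gt0 => e /andP[].
by move=> e eu; apply: dvdn_biglcmn => //; apply: exponent_le _ _ _ Fchi0 eu.
Qed.
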